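(* Let $n\ge 0$ be a natural number. Then (i) for any discrete field $K$, the polynomial ring $K[X_1,\ldots,X_n]$ is $(1+n)$-Jacobson; and (ii) the polynomial ring $\mathbb{Z}[X_1,\ldots,X_n]$ is $(2+n)$-Jacobson.
   Context: All rings are commutative with identity (the trivial ring is allowed). A ring $K$ is called a discrete field if every element of $K$ is zero or invertible (classically, every field is a discrete field). For a subset $U$ of a ring $A$, $\langle U\rangle$ denotes the ideal generated by $U$. $\mathrm{Nil}_A 0:=\{x\in A:\exists n\ge 0,\ x^n=0\}$ is the nilradical. The image of an element in a quotient ring is denoted by the same letter. For a ring $A$, elements $x,x'\in A$ and an ordinal $\alpha$, the property ''the triple $(A,x,x')$ is $\alpha$-Jacobson'' is defined by recursion on $\alpha$: (1) $(A,x,x')$ is $0$-Jacobson if $x'\in\mathrm{Nil}_A 0$. (2) For $\alpha>0$, $(A,x,x')$ is $\alpha$-Jacobson if there exist $n\ge 0$ and $a_1,\ldots,a_n\in A$ such that for any $b_1,\ldots,b_n\in A$ there exists an ordinal $\beta<\alpha$ such that $(A/\langle 1-b_i(1-a_ix): i\in\{1,\ldots,n\}\rangle,\,x,\,x')$ is $\beta$-Jacobson. A ring $A$ is called $\alpha$-Jacobson if $(A,x,x)$ is $\alpha$-Jacobson for all $x\in A$. *)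

(* Defs.v *)
From HB Require Import structures.
From mathcomp Require Import all_boot all_order all_algebra finmap.
From mathcomp Require Import generic_quotient ring_quotient boolp.
From mathcomp.multinomials Require Import xfinmap monalg.

Set Implicit Arguments.
Unset Strict Implicit.
Unset Printing Implicit Defensive.

Import Order.TTheory GRing.Theory.
Local Open Scope ring_scope.
Local Open Scope quotient_scope.

(* Rings are [comPzRingType]: commutative, possibly trivial. *)

(* There is no unit predicate on [comPzRingType], so invertibility is
   written out. The trivial ring is a discrete field. *)
Definition discrete_field (K : comPzRingType) : Prop :=
  forall x : K, x = 0 \/ exists y : K, x * y = 1.

Definition nilradical (A : comPzRingType) (x : A) : Prop :=
  exists n : nat, x ^+ n = 0.

(* The quotient of a ring by <c_0, ..., c_(n-1)>. The ring structure that
   [ring_quotient] puts on [Quotient.quot] needs a proper ideal of a nontrivial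
   ring, so only its additive structure is reused here. *)
Section QuotientByFamily.
Variables (A : comPzRingType) (n : nat) (c : 'I_n -> A).

Definition ideal_gen : {pred A} :=
  fun x => `[< exists r : 'I_n -> A, x = \sum_(i < n) r i * c i >].

Lemma ideal_genP x :
  reflect (exists r : 'I_n -> A, x = \sum_(i < n) r i * c i)
          (x \in ideal_gen).
Proof. exact: asboolP. Qed.

Lemma ideal_gen_zmod_closed : zmod_closed ideal_gen.
Proof.
split=> [|x y /ideal_genP[r ->] /ideal_genP[s ->]].
  by apply/ideal_genP; exists (fun=> 0); rewrite big1 // => i _; rewrite mul0r.
apply/ideal_genP; exists (fun i => r i - s i); rewrite -sumrB.
by apply: eq_bigr => i _; rewrite mulrBl.
Qed.

HB.instance Definition _ :=
  GRing.isZmodClosed.Build A ideal_gen ideal_gen_zmod_closed.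

Lemma ideal_genMl a x : x \in ideal_gen -> a * x \in ideal_gen.
Proof.
move=> /ideal_genP[r ->]; apply/ideal_genP; exists (fun i => a * r i).
by rewrite mulr_sumr; apply: eq_bigr => i _; rewrite mulrA.
Qed.

Lemma ideal_gen_mem i : c i \in ideal_gen.
Proof.
apply/ideal_genP; exists (fun j => (j == i)%:R).
rewrite (bigD1 i) //= eqxx mul1r big1 ?addr0 // => j /negbTE->.
by rewrite mul0r.
Qed.

Definition quot_ring := Quotient.quot ideal_gen.

HB.instance Definition _ := GRing.Zmodule.on quot_ring.
HB.instance Definition _ := EqQuotient.on quot_ring.

Definition quot_one : quot_ring := lift_cst quot_ring 1.
Definition quot_mul := lift_op2 quot_ring *%R.

Canonical quot_one_morph := PiConst quot_one.

Lemma pi_quot_mul :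
  {morph \pi_quot_ring : x y / x * y >-> quot_mul x y}.
Proof.
move=> x y; unlock quot_mul; apply/eqP.
rewrite -Quotient.idealrBE.
set x' := repr _; set y' := repr _.
have ex : x - x' \in ideal_gen by rewrite Quotient.idealrBE reprK.
have ey : y - y' \in ideal_gen by rewrite Quotient.idealrBE reprK.
have -> : x * y - x' * y' = y * (x - x') + x' * (y - y').
  by rewrite !mulrBr addrA [y * x]mulrC [y * x']mulrC subrK.
by rewrite rpredD // ideal_genMl.
Qed.
Canonical quot_mul_morph := PiMorph2 pi_quot_mul.

Lemma quot_mulA : associative quot_mul.
Proof. by move=> x y z; rewrite -[x]reprK -[y]reprK -[z]reprK !piE mulrA. Qed.

Lemma quot_mulC : commutative quot_mul.
Proof. by move=> x y; rewrite -[x]reprK -[y]reprK !piE mulrC. Qed.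

Lemma quot_mul1 : left_id quot_one quot_mul.
Proof. by move=> x; rewrite -[x]reprK !piE mul1r. Qed.

Lemma quot_mulDl : left_distributive quot_mul +%R.
Proof.
by move=> x y z; rewrite -[x]reprK -[y]reprK -[z]reprK !piE mulrDl.
Qed.

HB.instance Definition _ := GRing.Zmodule_isComPzRing.Build quot_ring
  quot_mulA quot_mulC quot_mul1 quot_mulDl.

Definition quot_proj (x : A) : quot_ring := \pi_quot_ring x.

Lemma quot_proj_zmod_morphism : zmod_morphism quot_proj.
Proof. by move=> x y; rewrite /quot_proj !piE. Qed.

HB.instance Definition _ :=
  GRing.isZmodMorphism.Build A quot_ring quot_proj quot_proj_zmod_morphism.

Lemma quot_proj_monoid_morphism : monoid_morphism quot_proj.
Proof. by split=> [|x y]; rewrite /quot_proj !piE. Qed.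

HB.instance Definition _ :=
  GRing.isMonoidMorphism.Build A quot_ring quot_proj
    quot_proj_monoid_morphism.

Lemma quot_proj_eq0 x : (quot_proj x == 0) = (x \in ideal_gen).
Proof.
by rewrite -(raddf0 quot_proj) /quot_proj -Quotient.idealrBE subr0.
Qed.

Lemma quot_proj_surj (y : quot_ring) : exists x, quot_proj x = y.
Proof. by exists (repr y); rewrite /quot_proj reprK. Qed.

End QuotientByFamily.

(* Ordinals are elements of a well-ordered type: alpha stands for the order
   type of its set of predecessors, and the ordinals below alpha are exactly
   those predecessors. *)
Record wellOrder := WellOrder {
  wo_disp : Order.disp_t;
  wo_sort :> orderType wo_disp;
  wo_wf : well_founded (fun b a : wo_sort => (b < a)%O)
}.

Lemma nat_lt_wf : well_founded (fun b a : nat => (b < a)%O).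
Proof.
move=> a; suff H : forall m b, (b <= m)%N -> Acc (fun b a : nat => (b < a)%O) b.
  exact: (H a a).
elim=> [|m IHm] b le_bm; constructor=> k; rewrite ltEnat /= => lt_kb.
  by have := leq_trans lt_kb le_bm.
by apply: IHm; rewrite -ltnS (leq_trans lt_kb).
Qed.

(* The natural number k, seen in [omega], is the ordinal k. *)
Definition omega : wellOrder := WellOrder nat_lt_wf.

(* [jacobson_triple alpha x x'] : the triple (A, x, x') is alpha-Jacobson. *)
Inductive jacobson_triple (O : wellOrder) :
    O -> forall A : comPzRingType, A -> A -> Prop :=
| Jacobson0 (alpha : O) (A : comPzRingType) (x x' : A) :
    (forall beta : O, (alpha <= beta)%O) ->
    nilradical x' ->
    jacobson_triple alpha x x'
| JacobsonPos (alpha : O) (A : comPzRingType) (x x' : A) :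
    (exists beta : O, (beta < alpha)%O) ->
    (exists (n : nat) (a : 'I_n -> A), forall b : 'I_n -> A,
      exists2 beta : O, (beta < alpha)%O &
        let p := quot_proj (fun i : 'I_n => 1 - b i * (1 - a i * x)) in
        jacobson_triple beta (p x) (p x')) ->
    jacobson_triple alpha x x'.

Lemma jacobson_tripleP (O : wellOrder) (alpha : O) (A : comPzRingType)
    (x x' : A) :
  jacobson_triple alpha x x' <->
  ((forall beta : O, (alpha <= beta)%O) /\ nilradical x') \/
  ((exists beta : O, (beta < alpha)%O) /\
   exists (n : nat) (a : 'I_n -> A), forall b : 'I_n -> A,
     exists2 beta : O, (beta < alpha)%O &
       let p := quot_proj (fun i : 'I_n => 1 - b i * (1 - a i * x)) in
       jacobson_triple beta (p x) (p x')).
Proof.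
split; last by move=> [[]|[]]; [exact: Jacobson0|exact: JacobsonPos].
by case=> *; [left|right].
Qed.

Definition jacobson_ring (O : wellOrder) (alpha : O) (A : comPzRingType) :
  Prop := forall x : A, jacobson_triple alpha x x.

(* R[X_1, ..., X_n]: finitely supported functions from monomials to R. The
   library puts a ring structure on [{malg R['X_{1..n}]}] for nontrivial R
   only, hence this alias, with the same operations (see [mvpoly1E] and
   [mvpolyME] below), for all commutative R. *)
Definition mvpoly (R : comPzRingType) (n : nat) : Type := {malg R['X_{1..n}]}.

Section MvPoly.
Variables (R : comPzRingType) (n : nat).
Implicit Types g : {malg R['X_{1..n}]}.

HB.instance Definition _ := GRing.Zmodule.on (mvpoly R n).

Definition mvpoly_one : {malg R['X_{1..n}]} := << (1 : R) *g mone >>.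

Definition mvpoly_mul g1 g2 : {malg R['X_{1..n}]} :=
  \sum_(k1 <- msupp g1) \sum_(k2 <- msupp g2)
    << mcoeff k1 g1 * mcoeff k2 g2 *g mmul k1 k2 >>.

Local Open Scope fset_scope.

Lemma mvpoly_mulw (d1 d2 : {fset 'X_{1..n}}) g1 g2 :
  msupp g1 `<=` d1 -> msupp g2 `<=` d2 ->
  mvpoly_mul g1 g2 = \sum_(k1 <- d1) \sum_(k2 <- d2)
    << mcoeff k1 g1 * mcoeff k2 g2 *g mmul k1 k2 >>.
Proof.
move=> le_d1 le_d2; rewrite /mvpoly_mul (big_fset_incl _ le_d1) /=.
  apply/eq_bigr=> k1 _; apply/big_fset_incl => // k _ /mcoeff_outdom ->.
  by rewrite mulr0 monalgU0.
move=> k _ /mcoeff_outdom g1k.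
by rewrite big1 => // k' _; rewrite g1k mul0r monalgU0.
Qed.

Lemma mvpoly_mulC : commutative mvpoly_mul.
Proof.
move=> g1 g2; rewrite /mvpoly_mul exchange_big.
by apply/eq_bigr=> k2 _; apply/eq_bigr=> k1 _; rewrite mulrC mulmC.
Qed.

Lemma mvpoly_mul0 : left_zero 0 mvpoly_mul.
Proof. by move=> g; rewrite /mvpoly_mul msupp0 big_seq_fset0. Qed.

Lemma mvpoly_mulDl : left_distributive mvpoly_mul +%R.
Proof.
move=> g1 g2 g; have sub := @fsubset_refl _ (msupp g).
rewrite (mvpoly_mulw (msuppD_le g1 g2) sub).
rewrite (mvpoly_mulw (fsubsetUl (msupp g1) (msupp g2)) sub).
rewrite (mvpoly_mulw (fsubsetUr (msupp g1) (msupp g2)) sub).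
rewrite -big_split /=; apply/eq_bigr=> k1 _.
rewrite -big_split /=; apply/eq_bigr=> k2 _.
by rewrite mcoeffD mulrDl monalgUD.
Qed.

Lemma mvpoly_mulDr : right_distributive mvpoly_mul +%R.
Proof. by move=> g g1 g2; rewrite !(mvpoly_mulC g) mvpoly_mulDl. Qed.

Lemma mvpoly_mulUU c1 c2 k1 k2 :
  mvpoly_mul << c1 *g k1 >> << c2 *g k2 >> = << c1 * c2 *g mmul k1 k2 >>.
Proof.
by rewrite (mvpoly_mulw msuppU_le msuppU_le) !big_seq_fset1 !mcoeffUU.
Qed.

Lemma mvpoly_ind (P : {malg R['X_{1..n}]} -> Prop) :
  P 0 -> (forall g1 g2, P g1 -> P g2 -> P (g1 + g2)%R) ->
  (forall c k, P << c *g k >>) -> forall g, P g.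
Proof.
move=> P0 PD PU g; rewrite (monalgE g).
exact: (big_ind P).
Qed.

Lemma mvpoly_mulr0 : right_zero 0 mvpoly_mul.
Proof. by move=> g; rewrite mvpoly_mulC mvpoly_mul0. Qed.

Lemma mvpoly_mulA : associative mvpoly_mul.
Proof.
have := (mvpoly_mul0, mvpoly_mulr0, mvpoly_mulDl, mvpoly_mulDr, mvpoly_mulUU).
move: mvpoly_mul => m [[[[m0 mr0] mDl] mDr] mUU] g1 g2 g3.
elim/mvpoly_ind: g1 => [|g g' IHg IHg'|c1 k1]; first by rewrite !m0.
  by rewrite !mDl IHg IHg'.
move: << c1 *g k1 >> (mUU c1 ^~ k1) => u1 mU1.
elim/mvpoly_ind: g2 => [|g g' IHg IHg'|c2 k2]; first by rewrite mr0 !m0 mr0.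
  by rewrite mDl !mDr mDl IHg IHg'.
rewrite mU1; move: << c2 *g k2 >> (mUU c2 ^~ k2) => u2 mU2.
elim/mvpoly_ind: g3 => [|g g' IHg IHg'|c3 k3]; first by rewrite !mr0.
  by rewrite !mDr IHg IHg'.
by rewrite mU2 mU1 mUU mulrA mulmA.
Qed.

Lemma mvpoly_mul1 : left_id mvpoly_one mvpoly_mul.
Proof.
have := (mvpoly_mulr0, mvpoly_mulDr, mvpoly_mulUU 1 ^~ mone).
rewrite -/mvpoly_one; move: mvpoly_one mvpoly_mul => e m [[mr0 mDr] mU] g.
elim/mvpoly_ind: g => [|g g' IHg IHg'|c k]; first by rewrite mr0.
  by rewrite mDr IHg IHg'.
by rewrite mU mul1r mul1m.
Qed.

HB.instance Definition _ := GRing.Zmodule_isComPzRing.Build (mvpoly R n)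
  mvpoly_mulA mvpoly_mulC mvpoly_mul1 mvpoly_mulDl.

End MvPoly.

Lemma mvpoly1E (R : comNzRingType) n :
  (1 : mvpoly R n) = (1 : {malg R['X_{1..n}]}).
Proof. by []. Qed.

Lemma mvpolyME (R : comNzRingType) n (g1 g2 : {malg R['X_{1..n}]}) :
  ((g1 : mvpoly R n) * (g2 : mvpoly R n) : mvpoly R n) = g1 * g2.
Proof. by []. Qed.

(* Main.v *)
Require Import Defs.
From HB Require Import structures.
From mathcomp Require Import all_boot all_order all_algebra finmap.
From mathcomp Require Import ring zify boolp.
From mathcomp.multinomials Require Import monalg.

(* Let [A] be a noetherian ring all of whose domain quotients have zero
   Jacobson radical, and suppose that no prime [P] of [A] with [x] not in
   [P] starts a chain of [d] strict inclusions of primes. Only finitely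
   many primes [P] with [x] not in [P] start a chain of [d - 1] inclusions
   (they are minimal), and for each of them some [1 - a * x] is not
   invertible modulo [P]. With these [a]'s, no quotient occurring in the
   definition of a [d]-Jacobson triple retains any of these [P]'s, so the
   bound on chains drops by one, and after [d] steps [x] lies in every
   prime, i.e. is nilpotent.

   For [K[X_1, ..., X_n]] and [Z[X_1, ..., X_n]] the hypotheses hold by
   Hilbert's basis theorem, by the general Nullstellensatz, and by a chain
   bound obtained as follows. Given primes [Q_(n+1) < ... < Q_0] of
   [K[X_1, ..., X_n]] and [y_i] in [Q_i] but not in [Q_(i+1)], take a
   polynomial relation [F(y_0, ..., y_n) = 0] over [K]; dividing by powers
   of [y_n], ..., [y_0] and reducing modulo [Q_n], ..., [Q_0] in turn
   yields a nonzero constant in [Q_0]. Over [Z] there is one more step,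
   where the contraction to [Z] passes from [0] to [pZ]; there [F] is
   divided by its content, so that it remains nonzero modulo [p]. *)

Set Implicit Arguments.
Unset Strict Implicit.
Unset Printing Implicit Defensive.

Import Order.TTheory GRing.Theory Num.Theory.
Local Open Scope ring_scope.

(** * Primes, noetherian rings and chains *)

Section Ideals.
Variable A : comPzRingType.
Implicit Types (I J P Q : A -> Prop) (x y : A).

Definition ideal I :=
  [/\ I 0, forall x y, I x -> I y -> I (x + y) & forall a x, I x -> I (a * x)].

Definition prime_ideal P :=
  [/\ ideal P, ~ P 1 & forall x y, P (x * y) -> P x \/ P y].

Definition sub_ideal I J := forall x, I x -> J x.

Lemma ideal0 I : ideal I -> I 0. Proof. by case. Qed.

Lemma idealD I x y : ideal I -> I x -> I y -> I (x + y).
Proof. by case=> _ + _; apply. Qed.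

Lemma ideal_mull I a x : ideal I -> I x -> I (a * x).
Proof. by case=> _ _; apply. Qed.

Lemma ideal_mulr I a x : ideal I -> I x -> I (x * a).
Proof. by move=> idI Ix; rewrite mulrC; apply: ideal_mull. Qed.

Lemma idealN I x : ideal I -> I x -> I (- x).
Proof. by move=> idI Ix; rewrite -mulN1r; apply: ideal_mull. Qed.

Lemma idealB I x y : ideal I -> I x -> I y -> I (x - y).
Proof. by move=> idI Ix Iy; apply: idealD => //; apply: idealN. Qed.

Lemma ideal_sum I (T : Type) (r : seq T) (Pr : pred T) (F : T -> A) :
  ideal I -> (forall i, Pr i -> I (F i)) -> I (\sum_(i <- r | Pr i) F i).
Proof.
move=> idI IF; elim/big_rec: _ => [|i x Pi Ix]; first exact: ideal0.
by apply: idealD => //; apply: IF.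
Qed.

Lemma ideal_sub_trans I x y : ideal I -> I (x - y) -> I y -> I x.
Proof. by move=> idI Ixy Iy; rewrite -(subrK y x); apply: idealD. Qed.

Lemma prime_is_ideal P : prime_ideal P -> ideal P. Proof. by case. Qed.

Lemma prime_proper P : prime_ideal P -> ~ P 1. Proof. by case. Qed.

Lemma primeM P x y : prime_ideal P -> P (x * y) -> P x \/ P y.
Proof. by case=> _ _; apply. Qed.

Lemma primeX P x n : prime_ideal P -> P (x ^+ n) -> P x.
Proof.
move=> prP; elim: n => [/(prime_proper prP)//|n IHn].
by rewrite exprS => /(primeM prP)[].
Qed.

Definition adjoin I n (c : 'I_n -> A) : A -> Prop :=
  fun z => exists r : 'I_n -> A, I (z - \sum_i r i * c i).

Lemma adjoin_ideal I n (c : 'I_n -> A) : ideal I -> ideal (adjoin I c).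
Proof.
move=> idI; split=> [|x y [r Ir] [s Is]|a x [r Ir]].
- exists (fun=> 0); rewrite big1 ?subr0; first exact: ideal0.
  by move=> i _; rewrite mul0r.
- exists (fun i => r i + s i).
  under eq_bigr do rewrite mulrDl.
  by rewrite big_split opprD addrACA; apply: idealD.
- exists (fun i => a * r i); under eq_bigr do rewrite -mulrA.
  by rewrite -mulr_sumr -mulrBr; apply: ideal_mull.
Qed.

Lemma sub_adjoin I n (c : 'I_n -> A) : ideal I -> sub_ideal I (adjoin I c).
Proof.
move=> idI x Ix; exists (fun=> 0); rewrite big1 ?subr0 // => i _.
by rewrite mul0r.
Qed.

Lemma adjoin_mem I n (c : 'I_n -> A) i : ideal I -> adjoin I c (c i).
Proof.
move=> idI; exists (fun j => (j == i)%:R); rewrite (bigD1 i) //= eqxx mul1r.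
rewrite big1 ?addr0 ?subrr; first exact: ideal0.
by move=> j /negbTE->; rewrite mul0r.
Qed.

Definition adjoin1 I y := adjoin I (fun _ : 'I_1 => y).

Lemma adjoin1P I y z : adjoin1 I y z <-> exists r, I (z - r * y).
Proof.
split=> [[r]|[r Ir]]; first by rewrite big_ord1; exists (r ord0).
by exists (fun=> r); rewrite big_ord1.
Qed.

(** The maximal-element form; maximality is expressed by inclusions instead of equality of
    predicates. *)
Definition noetherian := forall S : (A -> Prop) -> Prop,
  (exists I, S I) -> (forall I, S I -> ideal I) ->
  exists2 I, S I & forall J, S J -> sub_ideal I J -> sub_ideal J I.

(* A maximal ideal among the counterexamples to [Prp] is prime: if [x * y] lies
   in it but neither factor does, both enlarged ideals satisfy [Prp]. *)
Lemma noetherian_prime_ind (Prp : (A -> Prop) -> Prop) :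
  noetherian ->
  (forall I, ideal I -> I 1 -> Prp I) ->
  (forall P, prime_ideal P -> Prp P) ->
  (forall I x y, ideal I -> I (x * y) ->
     Prp (adjoin1 I x) -> Prp (adjoin1 I y) -> Prp I) ->
  forall I, ideal I -> Prp I.
Proof.
move=> noeA P1 Ppr PM I idI; apply: contrapT => nPI.
have [||J [idJ nPJ] Jmax] := noeA (fun J => ideal J /\ ~ Prp J).
- by exists I.
- by move=> J [].
have adjP z : ~ J z -> Prp (adjoin1 J z).
  move=> nJz; apply: contrapT => nP; apply: nJz.
  apply: (Jmax (adjoin1 J z)); last exact: (@adjoin_mem J 1 _ ord0).
    by split=> //; apply: adjoin_ideal.
  exact: sub_adjoin.
apply: (nPJ); apply: Ppr; split=> // [J1|x y Jxy]; first by apply/nPJ/P1.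
have [Jx|/adjP Px] := EM (J x); first by left.
have [Jy|/adjP Py] := EM (J y); first by right.
by case: nPJ; apply: PM Jxy Px Py.
Qed.

(** Noetherian induction: if both enlargements of [I] contained [1], so would their product, which
    lies in [I] because [x * y] does. *)
Lemma exists_prime I : noetherian -> ideal I -> ~ I 1 ->
  exists2 P, prime_ideal P & sub_ideal I P.
Proof.
move=> noeA idI; move: I idI; apply: noetherian_prime_ind => //.
  by move=> P prP _; exists P.
move=> I x y idI Ixy IHx IHy nI1.
have [Ix1|nIx1] := EM (adjoin1 I x 1); last first.
  have [P prP sP] := IHx nIx1; exists P => // z Iz; apply: sP.
  exact: sub_adjoin.
have [Iy1|nIy1] := EM (adjoin1 I y 1); last first.
  have [P prP sP] := IHy nIy1; exists P => // z Iz; apply: sP.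
  exact: sub_adjoin.
case/adjoin1P: Ix1 => r Ir; case/adjoin1P: Iy1 => s Is; case: nI1.
have -> : 1 = (1 - r * x) + r * x * (1 - s * y) + r * s * (x * y) by ring.
apply: idealD => //; last exact: ideal_mull.
by apply: idealD => //; apply: ideal_mull.
Qed.

(** If one power of [x] lies in [I + (u)] and another in [I + (v)], their product lies in [I], since
    [u * v] does. *)
Lemma nilpotent_mod I x : noetherian -> ideal I ->
  (forall P, prime_ideal P -> sub_ideal I P -> P x) -> exists m, I (x ^+ m).
Proof.
move=> noeA idI; move: I idI; apply: noetherian_prime_ind => //.
- by move=> I idI I1 _; exists 0%N.
- by move=> P prP Px; exists 1%N; rewrite expr1; apply: Px.
move=> I u v idI Iuv IHu IHv Ix.
have [|m1 /adjoin1P[r Ir]] := IHu.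
  by move=> P prP sP; apply: Ix => // z Iz; apply/sP/sub_adjoin.
have [|m2 /adjoin1P[s Is]] := IHv.
  by move=> P prP sP; apply: Ix => // z Iz; apply/sP/sub_adjoin.
exists (m1 + m2)%N; rewrite exprD.
have -> : x ^+ m1 * x ^+ m2 = x ^+ m2 * (x ^+ m1 - r * u)
   + r * u * (x ^+ m2 - s * v) + r * s * (u * v) by ring.
apply: idealD => //; last exact: ideal_mull.
by apply: idealD => //; apply: ideal_mull.
Qed.

(* [jac k I x x'] says that [(A / I, x, x')] is [k]-Jacobson, the successive
   quotients being represented by ideals of the fixed ring [A]. *)
Fixpoint jac k I x x' : Prop :=
  match k with
  | 0 => exists m, I (x' ^+ m)
  | k'.+1 => exists n (a : 'I_n -> A), forall b : 'I_n -> A,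
      jac k' (adjoin I (fun i => 1 - b i * (1 - a i * x))) x x'
  end.

Lemma jac_nilpotent k I x x' m : ideal I -> I (x' ^+ m) -> jac k I x x'.
Proof.
elim: k I => [|k IHk] I idI Im /=; first by exists m.
exists 0%N, (fun=> 0) => b; apply: IHk; first exact: adjoin_ideal.
exact: sub_adjoin.
Qed.

(** Asking only for a surjection that kills [I] lets the induction compose [phi] with the next
    projection, without identifying iterated quotients of [B] with quotients of [A]. *)
Lemma jac_transport k I x x' : jac k I x x' ->
  forall (B : comPzRingType) (phi : {rmorphism A -> B}),
    (forall y : B, exists z, phi z = y) -> (forall z, I z -> phi z = 0) ->
  jacobson_triple (k : omega) (phi x) (phi x').
Proof.
elim: k I => [|k IHk] I /=.
  move=> [m Im] B phi phi_surj phiI; apply: Jacobson0 => //.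
  by exists m; rewrite -rmorphXn phiI.
move=> [n [a Ha]] B phi phi_surj phiI; apply: JacobsonPos.
  by exists k; rewrite ltEnat /=.
exists n, (phi \o a) => b'.
have [b def_b] : exists b, forall i, phi (b i) = b' i.
  by exists (fun i => projT1 (cid (phi_surj (b' i)))) => i; case: cid.
exists k; first by rewrite ltEnat /=.
set c' := fun i => _; pose q := quot_proj c'.
apply: (IHk _ (Ha b) _ (q \o phi : {rmorphism A -> _})) => [y|z [r Ir]].
  have [y' <-] := quot_proj_surj y; have [z <-] := phi_surj y'.
  by exists z.
have /eqP := phiI _ Ir; rewrite rmorphB subr_eq0 => /eqP /= ->.
apply/eqP; rewrite quot_proj_eq0; apply/ideal_genP; exists (phi \o r).
rewrite rmorph_sum; apply: eq_bigr => i _ /=.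
by rewrite rmorphM rmorphB rmorph1 rmorphM rmorphB rmorph1 rmorphM def_b.
Qed.

Fixpoint prime_chain k P : Prop :=
  match k with
  | 0 => True
  | k'.+1 => exists Q, [/\ prime_ideal Q, sub_ideal P Q, ~ sub_ideal Q P
                        & prime_chain k' Q]
  end.

(* Every domain [A / P] has zero Jacobson radical. *)
Definition jacobson_primes := forall P x, prime_ideal P -> ~ P x ->
  exists a, forall b, ~ P (1 - b * (1 - a * x)).

(* Under the chain bound, the primes concerned are minimal over [I], hence
   finite in number. *)
Lemma finite_witnesses d I x : noetherian -> jacobson_primes -> ideal I ->
  (forall P, prime_ideal P -> sub_ideal I P -> ~ P x -> ~ prime_chain d.+1 P) ->
  exists s : seq A, forall P, prime_ideal P -> sub_ideal I P -> ~ P x ->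
    prime_chain d P -> exists2 a, a \in s & forall b, ~ P (1 - b * (1 - a * x)).
Proof.
move=> noeA jacA idI; move: I idI; apply: noetherian_prime_ind => //.
- by move=> I idI I1 _; exists [::] => P prP sP; case: (prime_proper prP); auto.
- move=> P prP chP; have [Px|nPx] := EM (P x).
    by exists [::] => Q prQ sQ []; auto.
  have [a Ha] := jacA P x prP nPx; exists [:: a] => Q prQ sQ nQx chQ.
  exists a; rewrite ?mem_seq1 //.
  (* If [Q] were strictly larger than [P], its chain would extend to one of length [d + 1] starting
     at [P]. *)
  have [QP|nQP] := EM (sub_ideal Q P); first by move=> b /QP; apply: Ha.
  by have [] := chP P prP (fun _ => id) nPx; exists Q.
move=> I u v idI Iuv IHu IHv ch.
have [P prP sP nPx|s1 Hs1] := IHu.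
  by apply: ch => // z Iz; apply/sP/sub_adjoin.
have [P prP sP nPx|s2 Hs2] := IHv.
  by apply: ch => // z Iz; apply/sP/sub_adjoin.
exists (s1 ++ s2) => P prP sP nPx chP; have idP := prime_is_ideal prP.
have sub w : P w -> sub_ideal (adjoin1 I w) P.
  move=> Pw z /adjoin1P[r /sP Pr]; apply: (ideal_sub_trans idP Pr).
  exact: ideal_mull.
have [/sub Pu|/sub Pv] := primeM prP (sP _ Iuv).
  by have [a a_s Ha] := Hs1 P prP Pu nPx chP; exists a; rewrite ?mem_cat ?a_s.
have [a a_s Ha] := Hs2 P prP Pv nPx chP.
by exists a; rewrite ?mem_cat ?a_s ?orbT.
Qed.

Theorem jac_of_chain_bound d I x : noetherian -> jacobson_primes -> ideal I ->
  (forall P, prime_ideal P -> sub_ideal I P -> ~ P x -> ~ prime_chain d P) ->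
  jac d I x x.
Proof.
move=> noeA jacA; elim: d I => [|d IHd] I idI chI.
  apply: nilpotent_mod => // P prP sP; apply: contrapT => nPx.
  exact: (chI P prP sP nPx).
have [s Hs] := finite_witnesses noeA jacA idI chI.
exists (size s), (fun i => s`_i) => b; apply: IHd; first exact: adjoin_ideal.
(* A prime over the enlarged ideal that still starts a chain of length [d] has a witness [a] in [s],
   yet it contains the generator [1 - b * (1 - a * x)] attached to [a]. *)
move=> P prP sP nPx chP.
have IP : sub_ideal I P by move=> z Iz; apply/sP/sub_adjoin.
have [a a_s Ha] := Hs P prP IP nPx chP.
have lt_i : (index a s < size s)%N by rewrite index_mem.
apply: (Ha (b (Ordinal lt_i))); apply: sP.
have := adjoin_mem (fun i : 'I_(size s) => 1 - b i * (1 - s`_i * x))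
  (Ordinal lt_i) idI.
by rewrite /= nth_index.
Qed.

End Ideals.

Lemma preimage_prime (A B : comPzRingType) (phi : {rmorphism A -> B})
  (P : B -> Prop) : prime_ideal P -> prime_ideal (fun x => P (phi x)).
Proof.
move=> prP; have idP := prime_is_ideal prP; split=> [||x y].
- split=> [|x y Px Py|a x Px]; first by rewrite rmorph0; apply: ideal0.
    by rewrite rmorphD; apply: idealD.
  by rewrite rmorphM; apply: ideal_mull.
- by rewrite rmorph1; apply: (prime_proper prP).
- by rewrite rmorphM; apply: primeM.
Qed.

(** * The passage from [R] to [R[X]] *)

Section HilbertBasis.
Variable R : comNzRingType.
Implicit Types (I J : {poly R} -> Prop).

(** Leading coefficients in degree [i]; bounding the size instead of fixing it admits zero and
    cancelled top terms, which makes this an ideal. *)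
Definition leading_ideal I i (c : R) :=
  exists f : {poly R}, [/\ I f, (size f <= i.+1)%N & f`_i = c].

Lemma leading_ideal_ideal I i : ideal I -> ideal (leading_ideal I i).
Proof.
move=> idI; split.
- by exists 0; rewrite size_poly0 coef0; split=> //; apply: ideal0.
- move=> c d [f [If sf <-]] [g [Ig sg <-]]; exists (f + g).
  rewrite coefD; split=> //; first exact: idealD.
  by rewrite (leq_trans (size_polyD _ _)) // geq_max sf sg.
- move=> a c [f [If sf <-]]; exists (a%:P * f).
  rewrite coefCM; split=> //; first exact: ideal_mull.
  by rewrite mul_polyC (leq_trans (size_scale_leq _ _)).
Qed.

Lemma leading_ideal_leq I i j : ideal I -> (i <= j)%N ->
  sub_ideal (leading_ideal I i) (leading_ideal I j).
Proof.
move=> idI le_ij c [f [If sf <-]]; exists (f * 'X^(j - i)).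
rewrite coefMXn ltnNge leq_subr /= subKn //; split=> //.
  exact: ideal_mulr.
have [->|f0] := eqVneq f 0; first by rewrite mul0r size_poly0.
rewrite size_Mmonic ?monicXn // size_polyXn; lia.
Qed.

Lemma leading_ideal_sub I J i : sub_ideal I J ->
  sub_ideal (leading_ideal I i) (leading_ideal J i).
Proof. by move=> IJ c [f [/IJ Jf sf fi]]; exists f. Qed.

(** Subtracting from [f] in [J] an element of [I] with the same top coefficient lowers the size. *)
Lemma leading_ideal_inj I J : ideal I -> ideal J -> sub_ideal I J ->
  (forall i, sub_ideal (leading_ideal J i) (leading_ideal I i)) ->
  sub_ideal J I.
Proof.
move=> idI idJ IJ lJI f; elim: {f}(size f) {-2}f (leqnn (size f)).
  by move=> f; rewrite leqn0 size_poly_eq0 => /eqP -> _; apply: ideal0.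
move=> n IHn f sf Jf.
have /lJI [g [Ig sg gn]] : leading_ideal J n f`_n by exists f.
apply: (ideal_sub_trans idI _ Ig); apply: IHn; last first.
  by apply: idealB => //; apply: IJ.
apply/leq_sizeP => j le_nj; rewrite coefB.
move: le_nj; rewrite leq_eqVlt => /orP[/eqP <-|lt_nj].
  by rewrite gn subrr.
by rewrite !nth_default ?subr0 // (leq_trans _ lt_nj).
Qed.

(** Among all leading ideals of members of [S], a maximal one occurs at some [I1] and degree [a];
    above [I1] nothing changes in degrees at least [a]. The finitely many degrees below [a] are then
    maximised one after the other. *)
Lemma noetherian_poly : noetherian R -> noetherian {poly R}.
Proof.
move=> noeR S [I0 SI0] idS.
pose T L := exists I i, S I /\ L = leading_ideal I i.
have [||L [I1 [a [SI1 ->]]] Lmax] := noeR T.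
- by exists (leading_ideal I0 0), I0, 0%N.
- by move=> L [I [i [/idS idI ->]]]; apply: leading_ideal_ideal.
have stable m : exists I, [/\ S I, sub_ideal I1 I &
    forall J i, S J -> sub_ideal I J -> (i < m)%N ->
    sub_ideal (leading_ideal J i) (leading_ideal I i)].
  elim: m => [|m [I [SI sI stI]]]; first by exists I1; split.
  pose U L := exists J, [/\ S J, sub_ideal I J & L = leading_ideal J m].
  have [||L' [J [SJ sJ ->]] Jmax] := noeR U.
  - by exists (leading_ideal I m), I; split.
  - by move=> L' [J [/idS idJ _ ->]]; apply: leading_ideal_ideal.
  exists J; split=> // [x /sI /sJ //|J' i SJ' sJ'].
  rewrite ltnS leq_eqVlt => /orP[/eqP->|lt_im].
    apply: Jmax; last exact: leading_ideal_sub.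
    by exists J'; split=> // x /sJ /sJ'.
  move=> x /(stI J' i SJ' (fun x Ix => sJ' x (sJ x Ix)) lt_im).
  exact: leading_ideal_sub.
have [I [SI sI stI]] := stable a; exists I => // J SJ IJ.
apply: (leading_ideal_inj (idS _ SI) (idS _ SJ) IJ) => i.
have [lt_ia|le_ai] := ltnP i a; first exact: stI.
have sub1 : sub_ideal (leading_ideal J i) (leading_ideal I1 a).
  apply: Lmax; first by exists J, i.
  move=> c /(leading_ideal_leq (idS _ SI1) le_ai).
  by apply: leading_ideal_sub => x /sI /IJ.
move=> c /sub1 /(leading_ideal_leq (idS _ SI1) le_ai).
exact: leading_ideal_sub.
Qed.

End HilbertBasis.

(** * Degree and pseudo-division modulo a prime of the coefficients *)

Section PolynomialsModPrime.
Variables (R : comNzRingType) (p : R -> Prop).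
Hypothesis prp : prime_ideal p.
Implicit Types f g h q r : {poly R}.

Let idp : ideal p := prime_is_ideal prp.

(* [mod_small n f]: modulo [p], [f] has degree less than [n];
   [mod_top n f]: modulo [p], [f] has degree exactly [n]. *)
Definition mod_small n f := forall i, (n <= i)%N -> p f`_i.
Definition mod_top n f := ~ p f`_n /\ mod_small n.+1 f.

Lemma exists_mod_top f : ~ mod_small 0 f -> exists n, mod_top n f.
Proof.
have: mod_small (size f) f.
  by move=> i le_i; rewrite nth_default //; apply: ideal0.
elim: (size f) => [//|n IHn] sf ns.
have [pn|npn] := EM (p f`_n); last by exists n.
apply: IHn => // i; rewrite leq_eqVlt => /orP[/eqP <- //|]; exact: sf.
Qed.

Lemma mod_small_leq m n f : (m <= n)%N -> mod_small m f -> mod_small n f.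
Proof. by move=> le_mn sf i le_ni; apply: sf; apply: leq_trans le_ni. Qed.

Lemma mod_top_small m n f : mod_top m f -> mod_small n f -> (m < n)%N.
Proof. by move=> [npm _] sf; rewrite ltnNge; apply/negP => /sf. Qed.

Lemma mod_smallZ n c f : mod_small n f -> mod_small n (c *: f).
Proof. by move=> sf i le_ni; rewrite coefZ; apply: ideal_mull; auto. Qed.

Lemma mod_smallM n f g : mod_small 0 f -> mod_small n (f * g).
Proof.
move=> sf i _; rewrite coefM; apply: ideal_sum => // j _.
by apply: ideal_mulr => //; apply: sf.
Qed.

Lemma mod_topM m n f g : mod_top m f -> mod_top n g -> mod_top (m + n) (f * g).
Proof.
move=> [nfm sf] [ngn sg]; split=> [|i lt_i]; last first.
  rewrite coefM; apply: ideal_sum => // j _.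
  have [le_jm|lt_mj] := leqP j m; last by apply: ideal_mulr => //; apply: sf.
  by apply: ideal_mull => //; apply: sg; lia.
have lt_m : (m < (m + n).+1)%N by rewrite ltnS leq_addr.
rewrite coefM (bigD1 (Ordinal lt_m)) //= addKn => pfg.
have: p (f`_m * g`_n).
  apply: (ideal_sub_trans idp (y := - \sum_(i < (m + n).+1 |
    i != Ordinal lt_m) f`_i * g`_(m + n - i))).
    by rewrite opprK.
  apply: idealN => //; apply: ideal_sum => // j ne_j.
  have [lt_jm|le_mj] := ltnP j m.
    by apply: ideal_mull => //; apply: sg; lia.
  apply: ideal_mulr => //; apply: sf.
  rewrite ltn_neqAle le_mj andbT eq_sym.
  by apply: contraNneq ne_j => jm; apply/eqP/val_inj.
by case/(primeM prp).
Qed.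

(** Pseudo-division by [f] as if its degree were [n]: the terms above [n] have coefficients in [p]
    and do not affect the degree of the remainder modulo [p]. *)
Lemma mod_pdiv n f h : mod_top n f ->
  exists k q, mod_small n (f`_n ^+ k *: h - q * f).
Proof.
move=> [_ sf].
have [m] : exists m, mod_small m h.
  by exists (size h) => i le_i; rewrite nth_default //; apply: ideal0.
elim: m h => [|m IHm] h sh.
  exists 0%N, 0; rewrite mul0r subr0 expr0 scale1r.
  exact: mod_small_leq sh.
have [lt_mn|le_nm] := ltnP m n.
  exists 0%N, 0; rewrite mul0r subr0 expr0 scale1r.
  exact: mod_small_leq sh.
pose h1 := f`_n *: h - h`_m *: ('X^(m - n) * f).
have [|k [q sq]] := IHm h1.
  move=> i; rewrite leq_eqVlt => /orP[/eqP <-|lt_mi].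
    rewrite coefB !coefZ coefXnM ltnNge leq_subr /= subKn // mulrC subrr.
    exact: ideal0.
  rewrite coefB !coefZ coefXnM; case: ltnP => [|le_i]; first lia.
  apply: idealB => //; apply: ideal_mull => //; first exact: sh.
  by apply: sf; lia.
exists k.+1, (q + f`_n ^+ k *: (h`_m *: 'X^(m - n))).
suff -> : f`_n ^+ k.+1 *: h - (q + f`_n ^+ k *: (h`_m *: 'X^(m - n))) * f
  = f`_n ^+ k *: h1 - q * f by [].
rewrite /h1 scalerBr !scalerA -exprSr mulrDl opprD -!mul_polyC !polyCM; ring.
Qed.

End PolynomialsModPrime.

(** * The general Nullstellensatz *)

Section JacobsonPoly.
Variable R : comNzRingType.
Implicit Types (P : {poly R} -> Prop) (f g h q r x : {poly R}).

Definition contraction P : R -> Prop := fun c => P c%:P.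

Lemma contraction_prime P : prime_ideal P -> prime_ideal (contraction P).
Proof. exact: (preimage_prime (@polyC R)). Qed.

Section AtPrime.
Variables (P : {poly R} -> Prop).
Hypothesis prP : prime_ideal P.

Let idP : ideal P := prime_is_ideal prP.
Let p := contraction P.
Let prp : prime_ideal p := contraction_prime prP.
Let idp : ideal p := prime_is_ideal prp.

Lemma mod_small0_in f : mod_small p 0 f -> P f.
Proof.
move=> sf; rewrite -[f]coefK poly_def; apply: ideal_sum => // i _.
by rewrite -mul_polyC; apply: ideal_mulr => //; apply: sf.
Qed.

(** Here [P] is [p[X]]. Since [1 - 'X * x] has positive degree modulo [p], no multiple of it is
    congruent to [1]. *)
Lemma jacobson_extended_prime x : (forall f, P f -> mod_small p 0 f) ->
  ~ P x -> exists a, forall b, ~ P (1 - b * (1 - a * x)).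
Proof.
move=> PE nPx; have [n topx] : exists n, mod_top p n x.
  by apply: exists_mod_top => // /mod_small0_in.
exists 'X => b /PE sb.
have top1 : mod_top p n.+1 (1 - 'X * x).
  have topx_coef i : (1 - 'X * x)`_i.+1 = - x`_i.
    by rewrite coefB coef1 coefXM sub0r.
  split=> [|[//|i] lt_i]; rewrite topx_coef.
    by move=> /(idealN idp); rewrite opprK; case: topx.
  by apply: idealN => //; apply: (proj2 topx).
have [|m topb] := @exists_mod_top _ p prp b.
  move=> sb0; apply: (prime_proper prp).
  have := sb 0%N isT; rewrite coefB coef1 => /(ideal_sub_trans idp).
  by apply; apply: (@mod_smallM _ _ prp 0).
have [ntop _] := mod_topM prp topb top1; apply: ntop.
have := sb (m + n.+1)%N isT.
by rewrite coefB coef1 addnS sub0r => /(idealN idp); rewrite opprK.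
Qed.

(* [f] generates [P] up to [p[X]] and denominators outside [p]. *)
Section Algebraic.
Variables (n : nat) (f : {poly R}).
Hypotheses (Pf : P f) (topf : mod_top p n f).
Hypothesis fmin : forall h, P h -> mod_small p n h -> mod_small p 0 h.

(** Choose [g] in [P + (x)], outside [P], of least degree [m] modulo [p]. Dividing [g] by [f] gives
    [m < n], dividing [f] by [g] gives [m = 0], so [g] is a constant modulo [p]. *)
Lemma exists_contracted_multiple x : ~ P x ->
  exists e s, ~ p e /\ P (e%:P - s * x).
Proof.
move=> nPx; pose J g := exists s, P (g - s * x).
have JP g : P g -> J g by move=> Pg; exists 0; rewrite mul0r subr0.
have J_mul g h : J g -> J (h * g).
  by move=> [s Ps]; exists (h * s); rewrite -mulrA -mulrBr; apply: ideal_mull.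
have JB g h : J g -> J h -> J (g - h).
  move=> [s Ps] [t Pt]; exists (s - t).
  have -> : g - h - (s - t) * x = (g - s * x) - (h - t * x) by ring.
  exact: idealB.
pose good m := `[< exists g, [/\ J g, ~ P g & mod_top p m g] >].
have good_ex g : J g -> ~ P g -> exists m, good m /\ mod_top p m g.
  move=> Jg nPg; have [|m topg] := @exists_mod_top _ p prp g.
    by move/mod_small0_in.
  by exists m; split=> //; apply/asboolP; exists g.
have [|m0 [gm0 _]] := good_ex x _ nPx.
  by exists 1; rewrite mul1r subrr; apply: ideal0.
have [m /asboolP[g [Jg nPg topg]] mmin] := ex_minnP (ex_intro _ m0 gm0).
have {}mmin h k : J h -> mod_small p k h -> (k <= m)%N -> P h.
  move=> Jh sh le_km; apply: contrapT => nPh.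
  have [i [gi topi]] := good_ex h Jh nPh.
  by have := mmin i gi; have := mod_top_small topi sh; lia.
have lt_mn : (m < n)%N.
  rewrite ltnNge; apply/negP => le_nm.
  have [k [q sr]] := mod_pdiv prp g topf.
  have Pr : P (f`_n ^+ k *: g - q * f).
    apply: mmin sr le_nm; apply: JB; first by rewrite -mul_polyC; apply: J_mul.
    by apply: JP; apply: ideal_mull.
  have: P ((f`_n ^+ k)%:P * g).
    rewrite mul_polyC; apply: (ideal_sub_trans idP Pr); exact: ideal_mull.
  case/(primeM prP) => // /(primeX prp); exact: (proj1 topf).
(* The quotient [q] of [f] by [g] lies in [P], so its degree modulo [p] is at least [n] unless it
   vanishes there; then [q * g] has degree at least [n + m], more than that of [f]. *)
have m0E : m = 0%N.
  apply/eqP; rewrite -leqn0 leqNgt; apply/negP => lt_0m.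
  have [k [q sr]] := mod_pdiv prp f topg.
  set r := _ - _ in sr.
  have Pr : P r.
    apply: mmin sr (leqnn _); apply: JB.
      by rewrite -mul_polyC; apply: JP; apply: ideal_mull.
    exact: J_mul.
  have Pq : P q.
    have: P (q * g).
      rewrite (_ : q * g = g`_m ^+ k *: f - r); last by rewrite /r subKr.
      by apply: idealB => //; rewrite -mul_polyC; apply: ideal_mull.
    by case/(primeM prP).
  have top_kf : mod_top p n (g`_m ^+ k *: f).
    split; last by apply: mod_smallZ => //; case: topf.
    rewrite coefZ => /(primeM prp)[/(primeX prp)|]; first exact: (proj1 topg).
    exact: (proj1 topf).
  have [sq|nsq] := EM (mod_small p 0 q).
    have: mod_small p m (g`_m ^+ k *: f).
      move=> i le_i; have := sr i le_i; rewrite coefB => /(ideal_sub_trans idp).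
      by apply; apply: (@mod_smallM _ _ prp 0).
    by move/(mod_top_small top_kf); lia.
  have [l topq] := exists_mod_top prp nsq.
  have le_nl : (n <= l)%N.
    rewrite leqNgt; apply/negP => lt_ln; apply: nsq; apply: fmin => //.
    exact: mod_small_leq (proj2 topq).
  have [ntop _] := mod_topM prp topq topg; apply: ntop.
  have -> : q * g = g`_m ^+ k *: f - r by rewrite /r subKr.
  rewrite coefB; apply: idealB => //; last by apply: sr; lia.
  by apply: (proj2 top_kf); lia.
subst m; case: Jg => s Ps; exists g`_0, s; split; first exact: (proj1 topg).
have -> : (g`_0)%:P - s * x = (g - s * x) - (g - (g`_0)%:P) by ring.
apply: idealB => //; apply: mod_small0_in => -[|i] _.
  by rewrite coefB coefC eqxx subrr; apply: ideal0.
by rewrite coefB coefC subr0; apply: (proj2 topg).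
Qed.

(* If [1 - a * x] is invertible modulo [P], then so is
   [u := 1 - a0 * c * e0], and pseudo-division by [f] shows that every prime
   containing [p] and [u] contains [c], hence [1]. *)
Lemma jacobson_algebraic_prime x : noetherian R -> jacobson_primes R ->
  ~ P x -> exists a, forall b, ~ P (1 - b * (1 - a * x)).
Proof.
move=> noeR jacR nPx.
have [e0 [s [npe0 Pes]]] := exists_contracted_multiple nPx.
pose c := f`_n; have npc : ~ p c := proj1 topf.
have npe : ~ p (c * e0) by case/(primeM prp).
have [a0 Ha0] := jacR p (c * e0) prp npe.
exists ((a0 * c)%:P * s) => b Pb.
pose u := 1 - a0 * (c * e0).
(* Modulo [P], [s * x] equals [e0], so [1 - a * x] becomes [u]. *)
have Pbu : P (1 - b * u%:P).
  have -> : 1 - b * u%:P = (1 - b * (1 - (a0 * c)%:P * s * x))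
            + b * (a0 * c)%:P * (e0%:P - s * x).
    by rewrite /u polyCB polyC1 !polyCM; ring.
  by apply: idealD => //; apply: ideal_mull.
have [||m prm sm] := @exists_prime _ (adjoin1 p u) noeR.
- exact: adjoin_ideal.
- by move=> /adjoin1P[r]; apply: Ha0.
have idm := prime_is_ideal prm.
have pm : sub_ideal p m by move=> z pz; apply/sm/sub_adjoin.
have mu : m u by apply: sm; apply: (adjoin_mem _ ord0).
have nmc : ~ m c.
  move=> mc; apply: (prime_proper prm).
  have -> : 1 = u + a0 * e0 * c by rewrite /u; ring.
  by apply: idealD => //; apply: ideal_mull.
have topm : mod_top m n f by split=> // i /(proj2 topf); apply: pm.
(* For [n = 0], [f] would be the constant [c] up to [p[X]], which would put [c] in [p]. *)
have lt_0n : (0 < n)%N.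
  rewrite lt0n; apply/eqP => n0.
  have: P c%:P.
    have -> : c%:P = f - (f - c%:P) by rewrite subKr.
    apply: idealB => //; apply: mod_small0_in => i _.
    rewrite coefB coefC /c n0; case: i => [|i] /=.
      by rewrite subrr; apply: ideal0.
    by rewrite subr0; apply: (proj2 topf); rewrite n0.
  exact: npc.
have [k [q sr]] := mod_pdiv prp (1 - b * u%:P) topf.
(* The remainder lies in [P] and has degree less than [n] modulo [p], so by minimality its
   coefficients are all in [p]. *)
have {}sr : mod_small p 0 (f`_n ^+ k *: (1 - b * u%:P) - q * f).
  apply: fmin sr; apply: idealB => //; last exact: ideal_mull.
  by rewrite -mul_polyC; apply: ideal_mull.
(* Modulo [m], [u] vanishes and [c ^+ k] becomes equal to [q * f]. This is impossible: [c] is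
   nonzero there and [f] keeps its positive degree [n]. *)
have ckqf i : m ((f`_n ^+ k *: 1 - q * f)`_i).
  have -> : f`_n ^+ k *: 1 - q * f
    = (f`_n ^+ k *: (1 - b * u%:P) - q * f) + f`_n ^+ k *: (b * u%:P).
    by rewrite scalerBr; ring.
  rewrite coefD coefZ coefMC; apply: idealD => //; first exact/pm/sr.
  by do 2!apply: ideal_mull => //.
have [sq|nsq] := EM (mod_small m 0 q).
  have := ckqf 0%N.
  rewrite coefB coefZ coef1 mulr1 => /(ideal_sub_trans idm) mck.
  apply: nmc; apply: (primeX (n := k) prm).
  by apply: mck; apply: (@mod_smallM _ _ prm 0).
have [l topq] := exists_mod_top prm nsq.
have [ntop _] := mod_topM prm topq topm; apply: ntop.
have := ckqf (l + n)%N; rewrite coefB coefZ coef1.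
have -> : (l + n)%N == 0%N = false by lia.
by rewrite mulr0 sub0r => /(idealN idm); rewrite opprK.
Qed.

End Algebraic.

End AtPrime.

Theorem jacobson_primes_poly : noetherian R -> jacobson_primes R ->
  jacobson_primes {poly R}.
Proof.
move=> noeR jacR P x prP nPx; have prp := contraction_prime prP.
have [PE|nPE] := EM (forall f, P f -> mod_small (contraction P) 0 f).
  exact: jacobson_extended_prime.
(* Otherwise take for [f] an element of [P] of least degree modulo the contraction, among those
   outside its extension. *)
pose good n := `[< exists f, P f /\ mod_top (contraction P) n f >].
have [n0 gn0] : exists n, good n.
  apply: contrapT => ngood; apply: nPE => f Pf; apply: contrapT => nsf.
  have [n topf] := exists_mod_top prp nsf.
  by apply: ngood; exists n; apply/asboolP; exists f.
have [n /asboolP[f [Pf topf]] nmin] := ex_minnP (ex_intro _ n0 gn0).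
apply: (jacobson_algebraic_prime prP Pf topf) => // h Ph sh.
apply: contrapT => nsh; have [m toph] := exists_mod_top prp nsh.
have /nmin : good m by apply/asboolP; exists h.
by have := mod_top_small toph sh; lia.
Qed.

End JacobsonPoly.

(** * Algebraic dependence in iterated polynomial rings *)

Section LinearDependence.
Variable R : idomainType.

Lemma exists_linear_relation (S T : finType) (W : S -> T -> R) :
  (#|T| < #|S|)%N ->
  exists2 v : S -> R, exists s, v s != 0 & forall t, \sum_s v s * W s t = 0.
Proof.
move=> lt_TS.
(* [W] is padded with zero columns to a square matrix, whose determinant is therefore zero. *)
pose M : 'M[R]_#|S| :=
  \matrix_(i, j) oapp (W (enum_val i)) 0 (onth (enum T) j).
have /det0P[v v0 vM] : \det M == 0.
  rewrite (expand_det_col _ (Ordinal lt_TS)) big1 // => i _.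
  by rewrite mxE /= onth_default ?mul0r // -cardE.
exists (fun s => v ord0 (enum_rank s)) => [|t].
  apply: contrapT => v_eq0; case/eqP: v0; apply/rowP => i; rewrite mxE.
  apply/eqP/negPn/negP => vi; apply: v_eq0; exists (enum_val i).
  by rewrite enum_valK.
have lt_t : (enum_rank t < #|S|)%N := ltn_trans (ltn_ord _) lt_TS.
have := congr1 (fun u : 'rV_#|S| => u ord0 (Ordinal lt_t)) vM.
rewrite !mxE; apply: etrans.
rewrite (reindex (enum_val : 'I_#|S| -> S)) /=; last first.
  by apply: onW_bij; apply: enum_val_bij.
apply: eq_bigr => i _; rewrite enum_valK mxE /=.
by rewrite onthE (nth_map t) -?cardE ?ltn_ord // nth_enum_rank.
Qed.

End LinearDependence.

(** Adjoining variables one at a time gives access to induction through [{poly _}] and lets a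
    relation be read as a polynomial in its last variable. *)
Fixpoint iter_poly (R : idomainType) n : idomainType :=
  match n with 0 => R | m.+1 => {poly iter_poly R m} : idomainType end.

Section IterPoly.
Variable R : idomainType.

Fixpoint iter_polyC n : {rmorphism R -> iter_poly R n} :=
  match n return {rmorphism R -> iter_poly R n} with
  | 0 => idfun : {rmorphism R -> R}
  | m.+1 => (@polyC (iter_poly R m) \o iter_polyC m)
              : {rmorphism R -> {poly iter_poly R m}}
  end.

(* The variable adjoined at stage [m + 1] is sent to [y m]. *)
Fixpoint iter_eval (A : comNzRingType) (phi : {rmorphism R -> A})
    (y : nat -> A) n : {rmorphism iter_poly R n -> A} :=
  match n return {rmorphism iter_poly R n -> A} with
  | 0 => phi
  | m.+1 => horner_morph (fun x => mulrC (y m) (iter_eval phi y m x))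
             : {rmorphism {poly iter_poly R m} -> A}
  end.

Section Eval.
Variables (A : comNzRingType) (phi : {rmorphism R -> A}) (y : nat -> A).
Local Notation ev := (iter_eval phi y).

Lemma iter_evalC n c : ev n (iter_polyC n c) = phi c.
Proof. by elim: n => //= n IHn; rewrite horner_morphC. Qed.

Lemma iter_evalSC n f : ev n.+1 f%:P = ev n f.
Proof. by rewrite /= horner_morphC. Qed.

Lemma iter_evalX n : ev n.+1 'X = y n.
Proof. by rewrite /= horner_morphX. Qed.

Lemma eq_iter_eval (y' : nat -> A) n f : (forall i, (i < n)%N -> y i = y' i) ->
  ev n f = iter_eval phi y' n f.
Proof.
elim: n f => //= n IHn f eq_y; rewrite /horner_morph -eq_y //.
congr (_.[_]); apply: eq_map_poly => g; apply: IHn => i lt_in.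
by apply: eq_y; apply: ltnW.
Qed.

End Eval.

(** For an ideal [p], this is its extension to the polynomial ring. *)
Fixpoint iter_coefs_in (p : R -> Prop) n : iter_poly R n -> Prop :=
  match n return iter_poly R n -> Prop with
  | 0 => p
  | m.+1 => fun f : {poly iter_poly R m} => forall i, iter_coefs_in p f`_i
  end.

Lemma iter_coefs_in0 n (f : iter_poly R n) :
  iter_coefs_in (fun c => c = 0) f <-> f = 0.
Proof.
elim: n f => [|n IHn] f //=; split=> [f0|-> i]; last first.
  by rewrite coef0 IHn.
by apply/polyP => i; rewrite coef0; apply/IHn.
Qed.

(** Exponent vectors with entries below [N], nested like [iter_poly]. *)
Fixpoint exponents N n : finType :=
  match n with 0 => unit : finType | m.+1 => (exponents N m * 'I_N)%type end.

Lemma card_exponents N n : #|exponents N n| = (N ^ n)%N.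
Proof.
by elim: n => [|n IHn]; rewrite ?card_unit //= card_prod IHn card_ord expnSr.
Qed.

Fixpoint monomial N n : exponents N n -> iter_poly R n :=
  match n return exponents N n -> iter_poly R n with
  | 0 => fun=> 1
  | m.+1 => fun e => (monomial e.1)%:P * 'X^(e.2)
  end.

Fixpoint iter_coef N n : iter_poly R n -> exponents N n -> R :=
  match n return iter_poly R n -> exponents N n -> R with
  | 0 => fun f _ => f
  | m.+1 => fun (f : {poly iter_poly R m}) e => iter_coef f`_(e.2) e.1
  end.

Lemma iter_coef0 N n (e : exponents N n) : iter_coef (0 : iter_poly R n) e = 0.
Proof. by elim: n e => //= n IHn e; rewrite coef0. Qed.

Lemma iter_coefD N n (f g : iter_poly R n) (e : exponents N n) :
  iter_coef (f + g) e = iter_coef f e + iter_coef g e.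
Proof. by elim: n f g e => //= n IHn f g e; rewrite coefD. Qed.

Lemma iter_coef_sum N n (I : Type) (r : seq I) (F : I -> iter_poly R n)
  (e : exponents N n) :
  iter_coef (\sum_(i <- r) F i) e = \sum_(i <- r) iter_coef (F i) e.
Proof.
elim: r => [|i r IHr]; first by rewrite !big_nil iter_coef0.
by rewrite !big_cons iter_coefD IHr.
Qed.

Lemma iter_coefCM N n c (f : iter_poly R n) (e : exponents N n) :
  iter_coef (iter_polyC n c * f) e = c * iter_coef f e.
Proof. by elim: n f e => //= n IHn f e; rewrite coefCM. Qed.

Lemma iter_coef_monomial N n (e e' : exponents N n) :
  iter_coef (monomial e') e = (e' == e)%:R.
Proof.
elim: n e e' => [|n IHn] /= => [[] [] //|[e i] [e' i']] /=.
rewrite coefCM coefXn -pair_eqE /= andbC.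
rewrite -(inj_eq val_inj) eq_sym; case: eqP => _ /=.
  by rewrite mulr1 IHn.
by rewrite mulr0 iter_coef0.
Qed.

(** Degree at most [D] in each variable separately. *)
Fixpoint deg_bound D n : iter_poly R n -> Prop :=
  match n return iter_poly R n -> Prop with
  | 0 => fun=> True
  | m.+1 => fun f : {poly iter_poly R m} =>
      (size f <= D.+1)%N /\ forall i, deg_bound D f`_i
  end.

Lemma deg_bound0 D n : deg_bound D (0 : iter_poly R n).
Proof.
by elim: n => //= n IHn; rewrite size_poly0; split=> // i; rewrite coef0.
Qed.

Lemma deg_bound1 D n : deg_bound D (1 : iter_poly R n).
Proof.
elim: n => //= n IHn; rewrite size_poly1; split=> // i; rewrite coef1.
by case: eqP => _ //; apply: deg_bound0.
Qed.

Lemma deg_boundC n c : deg_bound 0 (iter_polyC n c).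
Proof.
elim: n => //= n IHn; split=> [|i]; first by rewrite size_polyC_leq1.
by rewrite coefC; case: eqP => _ //; apply: deg_bound0.
Qed.

Lemma deg_boundD D n (f g : iter_poly R n) :
  deg_bound D f -> deg_bound D g -> deg_bound D (f + g).
Proof.
elim: n f g => //= n IHn f g [sf bf] [sg bg]; split.
  by rewrite (leq_trans (size_polyD _ _)) // geq_max sf sg.
by move=> i; rewrite coefD; apply: IHn.
Qed.

Lemma deg_boundM D E n (f g : iter_poly R n) :
  deg_bound D f -> deg_bound E g -> deg_bound (D + E) (f * g).
Proof.
elim: n f g => //= n IHn f g [sf bf] [sg bg]; split.
  apply: leq_trans (size_polyMleq _ _) _; rewrite -subn1 leq_subLR.
  by rewrite add1n -addnS -addSn leq_add.
move=> i; rewrite coefM.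
elim/big_rec: _ => [|j h _ bh]; first exact: deg_bound0.
by apply: deg_boundD => //; apply: IHn.
Qed.

Lemma deg_bound_leq D E n (f : iter_poly R n) :
  (D <= E)%N -> deg_bound D f -> deg_bound E f.
Proof.
move=> le_DE; elim: n f => //= n IHn f [sf bf]; split; last by auto.
by rewrite (leq_trans sf).
Qed.

Lemma deg_boundX D k n (f : iter_poly R n) :
  deg_bound D f -> deg_bound (k * D) (f ^+ k).
Proof.
move=> bf; elim: k => [|k IHk]; first exact: deg_bound1.
by rewrite exprS mulSn; apply: deg_boundM.
Qed.

Lemma exists_common_bound (Q : nat -> nat -> Prop) m :
  (forall i D E, (D <= E)%N -> Q i D -> Q i E) ->
  (forall i, exists D, Q i D) -> exists D, forall i, (i < m)%N -> Q i D.
Proof.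
move=> Qle Qex; elim: m => [|m [D QD]]; first by exists 0%N.
have [E QE] := Qex m; exists (D + E)%N => i; rewrite ltnS leq_eqVlt.
case/orP=> [/eqP->|/QD]; first exact: Qle (leq_addl _ _) QE.
exact/Qle/leq_addr.
Qed.

Lemma exists_deg_bound n (f : iter_poly R n) : exists D, deg_bound D f.
Proof.
elim: n f => [|n IHn] f; first by exists 0%N.
have [i D E|D HD] := @exists_common_bound (fun i D => deg_bound D f`_i)
  (size f) _ (fun i => IHn _); first exact: deg_bound_leq.
exists (size f + D)%N; split=> [|i]; first by rewrite leqW // leq_addr.
have [/HD|le_i] := ltnP i (size f); first exact/deg_bound_leq/leq_addl.
by rewrite nth_default //; apply: deg_bound0.
Qed.

Lemma iter_coef_inj D n (f : iter_poly R n) : deg_bound D f ->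
  (forall e : exponents D.+1 n, iter_coef f e = 0) -> f = 0.
Proof.
elim: n f => [|n IHn] f /=; first by move=> _ /(_ tt).
move=> [sf bf] f0; apply/polyP => i; rewrite coef0.
have [lt_i|le_i] := ltnP i D.+1; last by rewrite nth_default // (leq_trans sf).
by apply: IHn => // e; apply: (f0 (e, Ordinal lt_i)).
Qed.

Lemma deg_bound_monomial N D m n (y : nat -> iter_poly R n)
  (e : exponents N m) : (forall i, (i < m)%N -> deg_bound D (y i)) ->
  deg_bound (m * (N * D)) (iter_eval (iter_polyC n) y m (monomial e)).
Proof.
elim: m e => [|m IHm] e by_; first by rewrite rmorph1; apply: deg_bound1.
rewrite [monomial e]/= rmorphM rmorphXn iter_evalSC iter_evalX mulSn addnC.
apply: deg_boundM; first by apply: IHm => i lt_i; apply: by_; apply: ltnW.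
apply: (@deg_bound_leq (e.2 * D)); last by apply: deg_boundX; apply: by_.
by rewrite leq_mul2r ltnW ?orbT.
Qed.

(* There are more monomials of degree less than [N] in [n + 1] variables than
   the space containing their values has dimensions. *)
Theorem exists_algebraic_relation n (y : nat -> iter_poly R n) :
  exists2 F : iter_poly R n.+1, F != 0 &
    iter_eval (iter_polyC n) y n.+1 F = 0.
Proof.
have [i D E|D byD] := @exists_common_bound (fun i D => deg_bound D (y i)) n.+1
  _ (fun i => exists_deg_bound (y i)); first exact: deg_bound_leq.
(* Monomials with exponents below [N] take values of degree at most [L] in each variable. As
   [L + 1 <= N * B] and [B ^ n < N], the dimension [(L + 1) ^ n] is at most [N ^ n * B ^ n], less
   than the number [N ^ (n + 1)] of monomials. *)
pose B := (n.+1 * D).+1; pose N := (B ^ n).+1; pose L := (n.+1 * (N * D))%N.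
pose W (e : exponents N n.+1) (e' : exponents L.+1 n) :=
  iter_coef (iter_eval (iter_polyC n) y n.+1 (monomial e)) e'.
have [|v [e0 ve0] vW] := @exists_linear_relation R _ _ W.
  rewrite !card_exponents expnSr.
  have le_L : (L.+1 <= N * B)%N by rewrite /L /B; nia.
  apply: (@leq_ltn_trans ((N * B) ^ n)).
    by case: (n) => // k; rewrite leq_exp2r.
  by rewrite expnMn ltn_mul2l expn_gt0 /= ltnSn.
exists (\sum_e iter_polyC n.+1 (v e) * monomial e).
  apply: contraNneq ve0 => F0; apply/eqP.
  have := congr1 (fun f => iter_coef f e0) F0.
  rewrite iter_coef0 iter_coef_sum (bigD1 e0) // big1 => [|e ne_e].
    rewrite iter_coefCM iter_coef_monomial eqxx mulr1.
    exact: etrans (esym (addr0 _)).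
  by rewrite iter_coefCM iter_coef_monomial (negbTE ne_e) mulr0.
rewrite rmorph_sum; apply: (@iter_coef_inj L) => [|e'].
  elim/big_rec: _ => [|e h _ bh]; first exact: deg_bound0.
  apply: deg_boundD => //; rewrite rmorphM iter_evalC -[L]add0n.
  apply: deg_boundM; last exact: deg_bound_monomial.
  exact: deg_boundC.
rewrite iter_coef_sum -[RHS](vW e'); apply: eq_bigr => e _.
by rewrite rmorphM iter_evalC iter_coefCM.
Qed.

End IterPoly.

(** * Chains of primes *)

Section Descent.
Variables (R : idomainType) (A : comNzRingType) (phi : {rmorphism R -> A}).
Implicit Types (p : R -> Prop) (P Q : A -> Prop) (y : nat -> A).

Lemma iter_coefs_in_zero p n : ideal p -> iter_coefs_in p (0 : iter_poly R n).
Proof.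
move=> idp; elim: n => [|n IHn] /=; first exact: ideal0.
by move=> i; rewrite coef0.
Qed.

Lemma iter_evalS y n (f : {poly iter_poly R n}) :
  iter_eval phi y n.+1 f = \sum_(i < size f) iter_eval phi y n f`_i * y n ^+ i.
Proof.
rewrite -{1}[f]coefK poly_def rmorph_sum; apply: eq_bigr => i _.
by rewrite -mul_polyC rmorphM rmorphXn iter_evalSC iter_evalX.
Qed.

Lemma iter_coefs_in_eval p P y n (f : iter_poly R n) :
  ideal P -> (forall c, p c -> P (phi c)) -> iter_coefs_in p f ->
  P (iter_eval phi y n f).
Proof.
move=> idP pP; elim: n f => [|n IHn] f pf; first exact: pP.
rewrite iter_evalS; apply: ideal_sum => // i _.
by apply: ideal_mulr => //; apply: IHn; apply: pf.
Qed.

Lemma iter_eval_coef0 Q y n (f : {poly iter_poly R n}) : ideal Q -> Q (y n) ->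
  Q (iter_eval phi y n f`_0 - iter_eval phi y n.+1 f).
Proof.
move=> idQ Qy; elim/poly_ind: f => [|f c _].
  by rewrite coef0 !rmorph0 subrr; apply: ideal0.
rewrite coefD coefMX coefC add0r rmorphD rmorphM iter_evalSC iter_evalX.
by rewrite opprD addrC subrK; apply: idealN => //; apply: ideal_mull.
Qed.

(* Modulo [P], divide [F] by the largest possible power of [y n], a regular
   element there; then reduce modulo [Q], where [y n] vanishes. *)
Lemma descent_step p P Q y n (F : iter_poly R n.+1) :
  ideal p -> prime_ideal P -> ideal Q -> sub_ideal P Q ->
  (forall c, p c -> P (phi c)) -> Q (y n) -> ~ P (y n) ->
  ~ iter_coefs_in p F -> P (iter_eval phi y n.+1 F) ->
  exists2 F' : iter_poly R n, ~ iter_coefs_in p F' & Q (iter_eval phi y n F').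
Proof.
move=> idp prP idQ PQ pP Qy nPy nF PF; have idP := prime_is_ideal prP.
pose f : {poly iter_poly R n} := F.
pose bad i := `[< ~ iter_coefs_in p f`_i >].
have [i0 bad_i0] : exists i, bad i.
  apply: contrapT => nbad; apply: nF => i; apply: contrapT => nFi.
  by apply: nbad; exists i; apply/asboolP.
(* The terms below the least bad index [i] evaluate into [P]; what remains is a multiple of
   [y n ^+ i] whose other factor has constant coefficient [f_i]. *)
have [i /asboolP nFi imin] := ex_minnP (ex_intro _ i0 bad_i0).
exists f`_i => //; rewrite -[i in f`_i]add0n -coef_drop_poly.
apply: (ideal_sub_trans idQ (iter_eval_coef0 _ idQ Qy)); apply: PQ.
have: P (iter_eval phi y n.+1 (drop_poly i f) * y n ^+ i).
  rewrite -(iter_evalX phi y n) -rmorphXn -rmorphM.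
  have -> : drop_poly i f * 'X^i = f - take_poly i f.
    by rewrite -{2}(poly_take_drop i f) addrC addKr.
  rewrite rmorphB; apply: idealB => //.
  apply: (iter_coefs_in_eval (p := p)) => // j /=; rewrite coef_take_poly.
  case: ltnP => [lt_ji|_]; last exact: iter_coefs_in_zero.
  apply: contrapT => nFj; have /imin : bad j by apply/asboolP.
  by rewrite leqNgt lt_ji.
by case/(primeM prP) => // /(primeX prP).
Qed.

(** The smallest prime has the largest index, so that eliminating the last variable, evaluated at
    [y i], leads from [Q i.+1] to [Q i]. *)
Definition descending (Q : nat -> A -> Prop) y j m :=
  (forall i, (j <= i <= m)%N -> prime_ideal (Q i)) /\
  (forall i, (j <= i < m)%N ->
     [/\ sub_ideal (Q i.+1) (Q i), Q i (y i) & ~ Q i.+1 (y i)]).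

Lemma descending_sub (Q : nat -> A -> Prop) y j m j' m' :
  (j <= j')%N -> (m' <= m)%N -> descending Q y j m -> descending Q y j' m'.
Proof.
by move=> le_j le_m [prQ dQ]; split=> i lt_i; [apply: prQ|apply: dQ]; lia.
Qed.

Lemma descending_le (Q : nat -> A -> Prop) y j m i k :
  descending Q y j m -> (j <= i)%N -> (i <= k)%N -> (k <= m)%N ->
  sub_ideal (Q k) (Q i).
Proof.
move=> [_ dQ] le_ji; elim: k => [|k IHk] le_ik le_km x.
  by move: le_ik; rewrite leqn0 => /eqP->.
move: le_ik; rewrite leq_eqVlt => /orP[/eqP-> //|lt_ik] Qx.
apply: IHk => //; first exact: ltnW.
by have [|sub _ _] := dQ k; [lia|apply: sub].
Qed.

Lemma descent p (Q : nat -> A -> Prop) y j m (F : iter_poly R m) :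
  ideal p -> (j <= m)%N -> descending Q y j m ->
  (forall c, p c -> Q m (phi c)) ->
  ~ iter_coefs_in p F -> Q m (iter_eval phi y m F) ->
  exists2 F' : iter_poly R j, ~ iter_coefs_in p F' & Q j (iter_eval phi y j F').
Proof.
move=> idp; elim: m F => [|m IHm] F.
  by rewrite leqn0 => /eqP-> _ _ nF QF; exists F.
rewrite leq_eqVlt => /orP[/eqP-> _ _ nF QF|]; first by exists F.
rewrite ltnS => le_jm dQ pQ nF QF.
have [prQ stepQ] := dQ; have [|sub Qy nQy] := stepQ m; first lia.
have [||F' nF' QF'] := descent_step idp _ _ sub pQ Qy nQy nF QF.
- by apply: prQ; lia.
- by apply/prime_is_ideal/prQ; lia.
apply: (IHm F') => // [|c /pQ /sub //].
exact: descending_sub dQ.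
Qed.

Lemma prime_chain_descending k P : prime_ideal P -> prime_chain k P ->
  exists (Q : nat -> A -> Prop) y, Q k = P /\ descending Q y 0 k.
Proof.
elim: k P => [|k IHk] P prP /=.
  by move=> _; exists (fun=> P), (fun=> 0); split=> //; split=> [//|i]; lia.
move=> [P' [prP' sub nsub chP']].
have [Q [y [defP' [prQ dQ]]]] := IHk _ prP' chP'.
have [z P'z nPz] : exists2 z, P' z & ~ P z.
  apply: contrapT => nz; apply: nsub => z P'z; apply: contrapT => nPz.
  by apply: nz; exists z.
exists (fun i => if i == k.+1 then P else Q i),
       (fun i => if i == k then z else y i).
rewrite eqxx; split=> //; split=> i le_i.
  by case: eqP => // ne_i; apply: prQ; lia.
have -> : (i == k.+1) = false by lia.
rewrite eqSS; case: eqP => [->|ne_i]; first by rewrite defP'.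
by apply: dQ; lia.
Qed.

End Descent.

Section ChainBounds.
Variables (R : idomainType) (n : nat).
Local Notation A := (iter_poly R n).
Implicit Types (Q : nat -> A -> Prop).

(** Serves for fields, and over the integers for chains whose primes all contract to zero. *)
Lemma no_descending_over_zero Q y : descending Q y 0 n.+1 ->
  (forall c, Q 0%N (iter_polyC R n c) -> c = 0) -> False.
Proof.
move=> dQ Q0; have [prQ _] := dQ.
have idQ : ideal (Q n.+1) by apply/prime_is_ideal/prQ; lia.
have [F F0 evF] := exists_algebraic_relation y.
have [||||||F' nF'] := @descent R A (iter_polyC R n)
    (fun c => c = 0) Q y 0 n.+1 F.
- by split=> [//|_ _ -> ->|a _ ->]; rewrite ?addr0 ?mulr0.
- by [].
- by [].
- by move=> c ->; rewrite rmorph0; apply: ideal0.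
- by rewrite iter_coefs_in0; apply/eqP.
- by rewrite evF; apply: ideal0.
by move/Q0.
Qed.

End ChainBounds.

Lemma iter_polyC_eq0 (R : idomainType) n (c : R) :
  iter_polyC R n c = 0 -> c = 0.
Proof. by elim: n => //= n IHn /eqP; rewrite polyC_eq0 => /eqP. Qed.

(** * The ring of integers *)

Section IntegerIdeals.
Implicit Types (I P : int -> Prop).

Lemma int_ideal_min I m : ideal I -> I m -> m != 0 ->
  (forall c, I c -> c != 0 -> (`|m| <= `|c|)%N) ->
  forall c, I c -> exists q, c = q * m.
Proof.
move=> idI Im m0 mmin c Ic; exists (c %/ m)%Z.
rewrite {1}(divz_eq c m); have [->|r0] := eqVneq (c %% m)%Z 0.
  by rewrite addr0.
have Ir : I (c %% m)%Z.
  have -> : (c %% m)%Z = c - (c %/ m)%Z * m.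
    by rewrite {2}(divz_eq c m) addrC addKr.
  by apply: idealB => //; apply: ideal_mull.
have := mmin _ Ir r0; have := ltz_mod c m0; have := modz_ge0 c m0; lia.
Qed.

Lemma int_ideal_principal I : ideal I ->
  exists2 m, I m & forall c, I c -> exists q, c = q * m.
Proof.
move=> idI; pose good k := `[< exists m : int, [/\ I m, m != 0 & `|m|%N = k] >].
have [[k0 gk0]|ngood] := EM (exists k, good k); last first.
  exists 0 => [|c Ic]; first exact: ideal0.
  have [->|c0] := eqVneq c 0; first by exists 0.
  by case: ngood; exists `|c|%N; apply/asboolP; exists c.
have [k /asboolP[m [Im m0 mk]] kmin] := ex_minnP (ex_intro _ k0 gk0).
exists m => //; apply: int_ideal_min => // c Ic c0.
by rewrite mk; apply: kmin; apply/asboolP; exists c.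
Qed.

Lemma noetherian_int : noetherian int.
Proof.
move=> S [I0 SI0] idS.
pose good k := `[< exists I, S I /\
  exists m : int, [/\ I m, m != 0 & `|m|%N = k] >].
have [[k0 gk0]|ngood] := EM (exists k, good k); last first.
  exists I0 => // J SJ _ c Jc; have [->|c0] := eqVneq c 0.
    by apply: ideal0; apply: idS.
  case: ngood; exists `|c|%N; apply/asboolP; exists J; split=> //.
  by exists c.
have [k /asboolP[I [SI [m [Im m0 mk]]]] kmin] := ex_minnP (ex_intro _ k0 gk0).
exists I => // J SJ IJ c Jc.
have [|q ->] := int_ideal_min (idS J SJ) (IJ m Im) m0 _ Jc.
  move=> d Jd d0; rewrite mk; apply: kmin; apply/asboolP; exists J.
  by split=> //; exists d.
by apply: ideal_mull => //; apply: idS.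
Qed.

(** Write [P = (w)] and [w = t * g] with [g] the gcd of [x] and [w]. If [g] is in [P], so is [x]; if
    [t] is, then [g] is a unit and Bezout inverts [x] modulo [w]. *)
Lemma int_prime_maximal P m x : prime_ideal P -> P m -> m != 0 -> ~ P x ->
  exists a, P (1 - a * x).
Proof.
move=> prP Pm m0 nPx; have idP := prime_is_ideal prP.
have [w Pw genP] := int_ideal_principal idP.
have w0 : w != 0.
  by apply: contraNneq m0 => w0; have [q ->] := genP m Pm; rewrite w0 mulr0.
have [u [v uvE]] := Bezoutz x w.
have /dvdzP[t wE] := dvdz_gcdr x w; have /dvdzP[z xE] := dvdz_gcdl x w.
have : P (t * gcdz x w) by rewrite -wE.
case/(primeM prP) => [/genP[q tE]|Pg]; last first.
  by case: nPx; rewrite xE; apply: ideal_mull.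
have qg1 : q * gcdz x w = 1.
  by apply: (mulIf w0); rewrite mul1r {3}wE tE; ring.
exists (q * u); have -> : 1 - q * u * x = q * v * w.
  by rewrite -qg1 -uvE; ring.
exact: ideal_mull.
Qed.

Lemma jacobson_primes_int : jacobson_primes int.
Proof.
move=> P x prP nPx; have idP := prime_is_ideal prP.
have [[m [Pm m0]]|nP] := EM (exists m, P m /\ m != 0).
  have [a Pa] := int_prime_maximal prP Pm m0 nPx; exists a => b Pb.
  apply: (prime_proper prP); apply: (ideal_sub_trans idP Pb).
  exact: ideal_mull.
(* Now [P] is zero, and [1 - 3 * x * x] is at most [-2], hence not a unit. *)
exists (3 * x) => b Pb.
have eq0 : 1 - b * (1 - 3 * x * x) = 0.
  by apply/eqP/negPn/negP => ne0; apply: nP; exists (1 - b * (1 - 3 * x * x)).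
have x0 : x != 0 by apply: contra_notN nPx => /eqP->; apply: ideal0.
have : (x * x >= 1) by nia.
rewrite -mulrA in eq0; move: (x * x) eq0 => t eq0 t1.
have [b0|b0] : b <= -1 \/ 0 <= b by lia.
  by nia.
by nia.
Qed.

Lemma int_coefs_divisible n (w : int) (p : int -> Prop) (F : iter_poly int n) :
  (forall c, p c -> exists q, c = q * w) -> iter_coefs_in p F ->
  exists F', F = iter_polyC int n w * F'.
Proof.
move=> genp; elim: n F => [|n IHn] F /= pF.
  by have [q ->] := genp F pF; exists q; rewrite mulrC.
have [g Fg] := choice (fun i => IHn _ (pF i)).
pose f : {poly iter_poly int n} := F.
exists (\poly_(i < size f) g i); apply/polyP => i; rewrite coefCM coef_poly.
case: ltnP => [_|le_i]; first exact: Fg.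
by rewrite nth_default ?mulr0.
Qed.

(** Its absolute value is the termination measure in [int_content]. *)
Fixpoint iter_lead n : iter_poly int n -> int :=
  match n return iter_poly int n -> int with
  | 0 => id
  | m.+1 => fun f : {poly iter_poly int m} => iter_lead (lead_coef f)
  end.

Lemma iter_leadCM n c (F : iter_poly int n) :
  iter_lead (iter_polyC int n c * F) = c * iter_lead F.
Proof. by elim: n F => //= n IHn F; rewrite lead_coefM lead_coefC. Qed.

Lemma iter_lead_eq0 n (F : iter_poly int n) : iter_lead F = 0 -> F = 0.
Proof. by elim: n F => //= n IHn F /IHn/eqP; rewrite lead_coef_eq0 => /eqP. Qed.

(** As long as all coefficients lie in [P = (w)], a factor [w] is extracted; [w] is not a unit, so
    [iter_lead] strictly decreases in absolute value. *)
Lemma int_content n P (F : iter_poly int n) : prime_ideal P -> F != 0 ->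
  exists s F', [/\ s != 0, F = iter_polyC int n s * F' & ~ iter_coefs_in P F'].
Proof.
move=> prP; have idP := prime_is_ideal prP.
have [w Pw genP] := int_ideal_principal idP.
have w1 : (`|w| != 1)%N.
  apply/eqP => w1; apply: (prime_proper prP).
  have w_unit : sgz w * w = 1 by lia.
  by have := ideal_mull (sgz w) idP Pw; rewrite w_unit.
have [k] := ubnP `|iter_lead F|%N; elim: k F => // k IHk F ltF F0.
have [PF|nPF] := EM (iter_coefs_in P F); last first.
  by exists 1, F; rewrite rmorph1 mul1r.
have [F1 FE] := int_coefs_divisible genP PF.
have [w0 F10] : w != 0 /\ F1 != 0.
  split; apply: contraNneq F0 => E; rewrite FE E ?mulr0 //.
  by rewrite rmorph0 mul0r.
have lead0 : iter_lead F1 != 0.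
  by apply: contraNneq F10 => /iter_lead_eq0->.
have [|s [F' [s0 F1E nPF']]] := IHk F1 _ F10.
  by move: ltF; rewrite FE iter_leadCM; nia.
exists (w * s), F'; split=> //; first by rewrite mulf_neq0.
by rewrite FE F1E rmorphM mulrA.
Qed.

End IntegerIdeals.

Theorem int_chain_bound n (P : iter_poly int n -> Prop) :
  prime_ideal P -> ~ prime_chain n.+2 P.
Proof.
move=> prP [P1 [prP1 sub1 nsub1 ch1]].
(* Replacing [P] by the zero ideal makes the bottom of the chain contract to zero. *)
pose Z (f : iter_poly int n) := f = 0.
have prZ : prime_ideal Z.
  split=> [||f g /eqP].
  - by split=> [//|_ _ -> ->|a _ ->]; rewrite /Z ?addr0 ?mulr0.
  - exact/eqP/oner_neq0.
  - by rewrite mulf_eq0 => /orP[]/eqP; [left|right].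
have chZ : prime_chain n.+2 Z.
  exists P1; split=> // [_ ->|sub]; first exact: (ideal0 (prime_is_ideal prP1)).
  by apply: nsub1 => x /sub ->; apply: (ideal0 (prime_is_ideal prP)).
have [Q [y [QZ dQ]]] := prime_chain_descending prZ chZ.
have [prQ stepQ] := dQ.
(* The least index contracting to zero is either [0], when the previous bound applies, or [j + 1],
   when the contraction [p] of [Q j] is nonzero. *)
pose flat i := `[< forall c, Q i (iter_polyC int n c) -> c = 0 >].
have [|[|j] /asboolP flatj jmin] := @ex_minnP flat.
- by exists n.+2; apply/asboolP => c; rewrite QZ => /iter_polyC_eq0.
- apply: (no_descending_over_zero (y := y) _ flatj).
  exact: descending_sub dQ.
have le_jn : (j <= n.+1)%N.
  rewrite -ltnS; apply: jmin; apply/asboolP => c.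
  by rewrite QZ => /iter_polyC_eq0.
have prQj : prime_ideal (Q j) by apply: prQ; lia.
pose p c := Q j (iter_polyC int n c).
have prp : prime_ideal p by apply: preimage_prime.
have idp := prime_is_ideal prp.
have [m pm m0] : exists2 m, p m & m != 0.
  apply: contrapT => nm; have /jmin : flat j; last by rewrite ltnn.
  apply/asboolP => c Qc; apply/eqP/negPn/negP => c0.
  by apply: nm; exists c.
(* The step between [Q j.+1] and [Q j] is skipped: omitting [y j] leaves [n + 1] elements, enough
   for a relation. The first descent, with zero coefficient ideal, stops at [Q j.+1]. *)
pose y' i := if (i < j)%N then y i else y i.+1.
have [F F0 evF] := exists_algebraic_relation y'.
have [|||||F1 nF1 QF1] := @descent _ _ (iter_polyC int n) (fun c => c = 0)
    (fun i => Q i.+1) y' j n.+1 F _ le_jn.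
- by split=> [//|_ _ -> ->|a _ ->]; rewrite ?addr0 ?mulr0.
- split=> i le_i; first by apply: prQ; lia.
  by rewrite /y' ltnNge (_ : (j <= i)%N) /=; [apply: stepQ|]; lia.
- by move=> c ->; rewrite QZ rmorph0.
- by rewrite iter_coefs_in0; apply/eqP.
- by rewrite QZ.
have F10 : F1 != 0 by apply: contra_notN nF1 => /eqP; rewrite -iter_coefs_in0.
have [s [F2 [s0 F1E nF2]]] := int_content prp F10.
have prQj1 : prime_ideal (Q j.+1) by apply: prQ; lia.
(* The content [s] is a nonzero integer, so it is not in [Q j.+1] and can be cancelled. *)
have QF2 : Q j (iter_eval (iter_polyC int n) y j F2).
  have [|sub _ _] := stepQ j; first lia.
  apply: sub; rewrite (@eq_iter_eval _ _ _ y y') => [|i lt_ij]; last first.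
    by rewrite /y' lt_ij.
  move: QF1; rewrite F1E rmorphM iter_evalC => /(primeM prQj1)[/flatj s_eq0|//].
  by rewrite s_eq0 in s0.
(* The second descent works modulo [p] and ends with an integer of [Q 0] outside [p]; since [p] is
   maximal and contained in [Q 0], this forces [1] into [Q 0]. *)
have [|||||c npc Qc] := @descent _ _ (iter_polyC int n) p Q y 0 j F2 idp.
- by [].
- by apply: descending_sub dQ; lia.
- by [].
- by [].
- by [].
have [a pa] := int_prime_maximal prp pm m0 npc.
have prQ0 : prime_ideal (Q 0%N) by apply: prQ.
have idQ0 := prime_is_ideal prQ0.
apply: (prime_proper prQ0).
apply: (ideal_sub_trans idQ0 (y := iter_polyC int n (a * c))).
  have /(_ _ pa) := descending_le dQ (leqnn 0) (leq0n j) (leqW le_jn).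
  by rewrite rmorphB rmorph1.
by rewrite rmorphM; apply: ideal_mull.
Qed.

(** * Fields *)

Section FieldIdeals.
Variable K : fieldType.
Implicit Types (I P : K -> Prop).

Lemma field_ideal I c : ideal I -> ~ I 1 -> I c -> c = 0.
Proof.
move=> idI nI1 Ic; apply/eqP/negPn/negP => c0; apply: nI1.
by rewrite -(mulVf c0); apply: ideal_mull.
Qed.

Lemma noetherian_field : noetherian K.
Proof.
move=> S [I0 SI0] idS.
have [[I [SI I1]]|nS1] := EM (exists I, S I /\ I 1).
  exists I => // J _ _ c _; rewrite -[c]mulr1; apply: ideal_mull => //.
  exact: idS.
exists I0 => // J SJ _ c Jc.
rewrite (field_ideal (idS J SJ) _ Jc); first exact: (ideal0 (idS I0 SI0)).
by move=> J1; apply: nS1; exists J.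
Qed.

Lemma jacobson_primes_field : jacobson_primes K.
Proof.
move=> P x prP nPx; exists x^-1 => b.
have x0 : x != 0.
  by apply: contra_notN nPx => /eqP->; apply: (ideal0 (prime_is_ideal prP)).
by rewrite mulVf // subrr mulr0 subr0; apply: prime_proper.
Qed.

Lemma field_chain_bound n (P : iter_poly K n -> Prop) :
  prime_ideal P -> ~ prime_chain n.+1 P.
Proof.
move=> prP /(prime_chain_descending prP)[Q [y [_ dQ]]].
apply: (no_descending_over_zero dQ) => c.
have /(preimage_prime (iter_polyC K n)) prQ0 : prime_ideal (Q 0%N).
  by apply: (proj1 dQ).
apply: (field_ideal (prime_is_ideal prQ0)); exact: (prime_proper prQ0).
Qed.

End FieldIdeals.

Lemma noetherian_iter_poly (R : idomainType) n :
  noetherian R -> noetherian (iter_poly R n).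
Proof. by move=> noeR; elim: n => //= n IHn; apply: noetherian_poly. Qed.

Lemma jacobson_primes_iter_poly (R : idomainType) n :
  noetherian R -> jacobson_primes R -> jacobson_primes (iter_poly R n).
Proof.
move=> noeR jacR; elim: n => //= n IHn; apply: jacobson_primes_poly => //.
exact: noetherian_iter_poly.
Qed.

(** * Transfer to multivariate polynomials *)

Section PolynomialImage.
Variables (R : comNzRingType) (n : nat).

Lemma mvpoly_one_neq0 : (1 : mvpoly R n) != 0.
Proof. by rewrite mvpoly1E oner_neq0. Qed.

HB.instance Definition _ :=
  GRing.PzSemiRing_isNonZero.Build (mvpoly R n) mvpoly_one_neq0.

Definition mvterm (c : R) (k : 'X_{1..n}) : mvpoly R n := << c *g k >>.

Lemma mvtermM c d k l :
  mvterm c k * mvterm d l = mvterm (c * d) (mmul k l).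
Proof. exact: mvpoly_mulUU. Qed.

Definition mvpolyC (c : R) : mvpoly R n := mvterm c mone.

Lemma mvpolyC_zmod_morphism : zmod_morphism mvpolyC.
Proof. by move=> c d; rewrite /mvpolyC /mvterm monalgUB. Qed.

HB.instance Definition _ :=
  GRing.isZmodMorphism.Build R (mvpoly R n) mvpolyC mvpolyC_zmod_morphism.

Lemma mvpolyC_monoid_morphism : monoid_morphism mvpolyC.
Proof. by split=> // c d; rewrite /mvpolyC mvtermM mul1m. Qed.

HB.instance Definition _ :=
  GRing.isMonoidMorphism.Build R (mvpoly R n) mvpolyC mvpolyC_monoid_morphism.

End PolynomialImage.

(** Variables are indexed by [nat] as [iter_eval] expects, with value [0] out of range. *)
Definition mvpolyX (R : comNzRingType) n (i : nat) : mvpoly R n :=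
  if insub i is Some j then mvterm 1 (ucm j) else 0.

(** Monomials are reached by induction on the degree, splitting off one variable; surjectivity is
    what [jac_transport] asks for. *)
Lemma mvpoly_image (R : idomainType) n (g : mvpoly R n) :
  exists F, iter_eval (@mvpolyC R n : {rmorphism R -> mvpoly R n})
                      (@mvpolyX R n) n F = g.
Proof.
set ev := iter_eval _ _.
have evX m (i : 'I_n) : (i < m)%N -> exists F, ev m F = mvterm 1 (ucm i).
  elim: m => // m IHm; rewrite ltnS leq_eqVlt => /orP[/eqP im|/IHm[F FE]].
    by exists 'X; rewrite /ev iter_evalX -im /mvpolyX valK.
  by exists F%:P; rewrite /ev iter_evalSC.
have evU (k : 'X_{1..n}) : exists F, ev n F = mvterm 1 k.
  have [d] := ubnP (mdeg k); elim: d k => // d IHd k le_k.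
  have [->|k1] := eqVneq k mone; first by exists 1; rewrite rmorph1.
  have [i ki] : exists i, k i != 0%N.
    apply: contrapT => k0; case/eqP: k1; apply/eqP/cmP => i.
    by rewrite cm1; apply/eqP/negPn/negP => ki; apply: k0; exists i.
  have kE : k = mmul (ucm i) (divcm k (ucm i)).
    apply/eqP/cmP => j; rewrite cmM divcmE cmU.
    case: eqP => [<-|_]; last by rewrite add0n subn0.
    by rewrite subnKC // lt0n.
  have [|F FE] := IHd (divcm k (ucm i)).
    by move: le_k; rewrite {1}kE mdegM mdegU.
  have [G GE] := evX n i (ltn_ord i).
  exists (G * F); rewrite rmorphM FE GE mvtermM -kE mulr1; reflexivity.
elim/mvpoly_ind: g => [|g1 g2 [F1 <-] [F2 <-]|c k].
- by exists 0; rewrite rmorph0.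
- by exists (F1 + F2); rewrite rmorphD.
have [F FE] := evU k; exists (iter_polyC R n c * F).
rewrite rmorphM FE /ev iter_evalC mvtermM mul1m mulr1; reflexivity.
Qed.

Lemma mvpoly_jacobson (R : idomainType) n d :
  noetherian R -> jacobson_primes R ->
  (forall P : iter_poly R n -> Prop, prime_ideal P -> ~ prime_chain d P) ->
  jacobson_ring (d : omega) (mvpoly R n).
Proof.
move=> noeR jacR bound g; have [F <-] := mvpoly_image g.
apply: (@jac_transport _ d (fun f => f = 0)) => [|y|_ ->].
- apply: jac_of_chain_bound => [|||P prP _ _].
  + exact: noetherian_iter_poly.
  + exact: jacobson_primes_iter_poly.
  + by split=> [//|_ _ -> ->|a _ ->]; rewrite ?addr0 ?mulr0.
  + exact: bound.
- exact: mvpoly_image.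
- exact: rmorph0.
Qed.

Lemma nontrivial_comNzRingType (K : comPzRingType) : (1 : K) != 0 ->
  exists N : comNzRingType, N = K :> comPzRingType.
Proof.
move=> K1.
exists (HB.pack K (GRing.PzSemiRing_isNonZero.Build K K1) : comNzRingType).
(* Once the record is destructed, both structures agree by computation. *)
by case: K K1.
Qed.

Lemma discrete_field_fieldType (N : comNzRingType) :
  discrete_field N -> exists F : fieldType, F = N :> comPzRingType.
Proof.
move=> dfN.
have invP (x : N) : exists y : N, (x != 0 -> y * x = 1) /\ (x = 0 -> y = 0).
  have [x0|[y xy]] := dfN x; first by exists 0; split=> //; rewrite x0 eqxx.
  exists y; split=> [_|x0]; first by rewrite mulrC.
  by have := oner_neq0 N; rewrite -xy x0 mul0r eqxx.
have [inv inv_spec] := choice invP.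
have mulVx (x : N) : x != 0 -> inv x * x = 1 := proj1 (inv_spec x).
have inv0 : inv 0 = 0 := proj2 (inv_spec 0) erefl.
pose isF := GRing.ComNzRing_isField.Build N mulVx inv0.
exists (HB.pack N isF : fieldType).
by case: N dfN invP inv inv_spec mulVx inv0 @isF.
Qed.

(** The trivial ring is a discrete field but carries no [fieldType] structure; its polynomial ring
    is zero, so every element is nilpotent. *)
Lemma trivial_mvpoly_jacobson (K : comPzRingType) n d : (1 : K) = 0 ->
  jacobson_ring (d : omega) (mvpoly K n).
Proof.
move=> K1 g; have g0 : g = 0.
  rewrite -[g]mul1r -[1]/(<< (1 : K) *g mone >>) K1 monalgU0.
  exact: mvpoly_mul0.
apply: (@jac_transport _ d (fun f => f = 0) _ _ _ _ idfun) => // [|y].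
  apply: (@jac_nilpotent _ _ _ _ _ 1); last by rewrite expr1.
  by split=> [//|_ _ -> ->|a _ ->]; rewrite ?addr0 ?mulr0.
by exists y.
Qed.

Theorem mainTheorem2 (n : nat) :
  (forall K : comPzRingType, discrete_field K ->
     jacobson_ring ((1 + n)%N : omega) (mvpoly K n)) /\
  jacobson_ring ((2 + n)%N : omega) (mvpoly int n).
Proof.
split=> [K dfK|].
  have [K1|K1] := eqVneq (1 : K) 0; first exact: trivial_mvpoly_jacobson.
  have [N NK] := nontrivial_comNzRingType K1; move: dfK; rewrite -NK.
  move=> /discrete_field_fieldType[F <-].
  apply: (@mvpoly_jacobson F); first exact: noetherian_field.
    exact: jacobson_primes_field.
  by move=> P; apply: field_chain_bound.
apply: (@mvpoly_jacobson int); first exact: noetherian_int.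
  exact: jacobson_primes_int.
by move=> P; apply: int_chain_bound.
Qed.
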